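(* Let $p\ge 2$ and $\nu\ge 1$ be integers, let $\omega\in\mathbb R^\nu$ be rationally independent, and write $\langle n\rangle=\sum_{j=1}^\nu n_j\omega_j$ for $n\in\mathbb Z^\nu$. Let $\hat u:\mathbb Z^\nu\to\mathbb C$ satisfy $$|\hat u(n)|\le \mathcal A^{\frac1{p-1}}e^{-\rho|n|},\qquad \forall n\in\mathbb Z^\nu,$$ where $\mathcal A>0$ and $0<\rho\le 1$. Put $$\mathcal L_p:=\left(1-\frac1p\right)^{p-1}\frac{\rho^{(p-1)\nu}}{\mathcal A\,6^{(p-1)\nu}} .$$ Then the quasi-periodic Cauchy problem $$u_t-u_{xxt}+u_x+u^{p-1}u_x=0,\qquad u(0,x)=\sum_{n\in\mathbb Z^\nu}\hat u(n)e^{i\langle n\rangle x},\qquad x\in\mathbb R,$$ has a unique spatially quasi-periodic solution in the classical sense on the time interval $[0,\mathcal L_p]$.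
   Context: $|n|=\sum_{j=1}^\nu|n_j|$ for $n\in\mathbb Z^\nu$. The vector $\omega$ is rationally independent (non-resonant) if $\langle n\rangle=0$ with $n\in\mathbb Z^\nu$ implies $n=0$. A spatially quasi-periodic solution in the classical sense on $[0,L]$ is a function of the form $u(t,x)=\sum_{n\in\mathbb Z^\nu}\hat u(t,n)e^{i\langle n\rangle x}$, with each $\hat u(\cdot,n):[0,L]\to\mathbb C$ continuously differentiable, such that the Fourier series of $u,u_t,u_x,u_{xxt},u^{p-1}u_x$ (obtained by termwise differentiation and by the Cauchy product) converge absolutely and uniformly on $[0,L]\times\mathbb R$, the equation holds at every point $(t,x)\in[0,L]\times\mathbb R$, and $u(0,x)$ equals the given initial data. Solutions may be complex valued. *)

(* Defs.v *)
From HB Require Import structures.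
From mathcomp Require Import all_boot all_order all_algebra.
From mathcomp Require Import finmap complex.
From mathcomp Require Import all_classical all_reals all_analysis.
From mathcomp Require Import showcase.summability.

Set Implicit Arguments.
Unset Strict Implicit.
Unset Printing Implicit Defensive.

Import Order.TTheory GRing.Theory Num.Theory.
Import numFieldNormedType.Exports.

Local Open Scope classical_set_scope.
Local Open Scope ring_scope.

(* The complex field R[i] packaged as a numFieldType: this is what gives it the
   topology and the norm of the analysis library. *)
Definition Cplx (R : realType) : numFieldType := R[i].

Definition norm1 (nu : nat) (n : 'rV[int]_nu) : nat :=
  (\sum_(j < nu) `|n ord0 j|)%N.

Definition freq (R : realType) (nu : nat) (omega : 'rV[R]_nu)
    (n : 'rV[int]_nu) : R :=
  \sum_(j < nu) (n ord0 j)%:~R * omega ord0 j.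

Definition rationally_independent (R : realType) (nu : nat)
    (omega : 'rV[R]_nu) : Prop :=
  forall n : 'rV[int]_nu, freq omega n = 0 -> n = 0.

Definition expi (R : realType) (theta : R) : Cplx R :=
  (cos theta +i* sin theta)%C.

Definition mode (R : realType) (nu : nat) (omega : 'rV[R]_nu)
    (n : 'rV[int]_nu) (x : R) : Cplx R :=
  expi (freq omega n * x).

(* The Fourier multiplier i<n> of d/dx. *)
Definition ifreq (R : realType) (nu : nat) (omega : 'rV[R]_nu)
    (n : 'rV[int]_nu) : Cplx R :=
  (0 +i* freq omega n)%C.

(* [has_derivative_in D f t l]: f has derivative l at t relative to D; at an
   endpoint of an interval D this is the one-sided derivative. *)
Definition has_derivative_in (R : realType) (D : set R) (f : R -> Cplx R)
    (t : R) (l : Cplx R) : Prop :=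
  (f s - f t) / (s - t)%:C%C @[s --> within D t^'] --> l.

(* Sums over Z^nu are limits of the partial sums along the directed set of all
   finite subsets ([totally], [partial_sum] and [sum] of summability). *)

Definition cauchy_product (R : realType) (nu : nat)
    (a b : 'rV[int]_nu -> Cplx R) (n : 'rV[int]_nu) : Cplx R :=
  summability.sum (fun m : 'rV[int]_nu => a (n - m) * b m).

Definition qp_series (R : realType) (nu : nat) (omega : 'rV[R]_nu)
    (c : 'rV[int]_nu -> Cplx R) (x : R) : Cplx R :=
  summability.sum (fun n : 'rV[int]_nu => c n * mode omega n x).

(* The series sum_n c t n * e^{i<n>x} converges absolutely at every point of
   [0, L] x R, and uniformly there to the function f. *)
Definition cvg_abs_unif (R : realType) (nu : nat) (omega : 'rV[R]_nu) (L : R)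
    (c : R -> 'rV[int]_nu -> Cplx R) (f : R -> R -> Cplx R) : Prop :=
  (forall t x : R, 0 <= t <= L ->
     esum.summable [set: 'rV[int]_nu]
       (fun n => (Normc.normc (c t n * mode omega n x))%:E)) /\
  {uniform [set z : R * R | 0 <= z.1 <= L],
     (fun (F : {fset 'rV[int]_nu}) (z : R * R) =>
        partial_sum (fun n => c z.1 n * mode omega n z.2) F) @ totally
     --> (fun z : R * R => f z.1 z.2)}.

Definition is_cvg_abs_unif (R : realType) (nu : nat) (omega : 'rV[R]_nu)
    (L : R) (c : R -> 'rV[int]_nu -> Cplx R) : Prop :=
  exists f : R -> R -> Cplx R, cvg_abs_unif omega L c f.

(* Pointwise validity on [0, L] x R of u_t - u_xxt + u_x + u^(p-1) u_x = 0,
   including the existence of the derivatives; u_xxt is the t-derivative of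
   u_xx. *)
Definition gBBM_on (R : realType) (p : nat) (L : R) (u : R -> R -> Cplx R)
    : Prop :=
  exists ut ux uxx uxxt : R -> R -> Cplx R,
  forall t x : R, 0 <= t <= L ->
  [/\ has_derivative_in `[0, L] (u ^~ x) t (ut t x),
      has_derivative_in setT (u t) x (ux t x),
      has_derivative_in setT (ux t) x (uxx t x),
      has_derivative_in `[0, L] (uxx ^~ x) t (uxxt t x) &
      ut t x - uxxt t x + ux t x + u t x ^+ p.-1 * ux t x = 0].

(* The coefficients of u^(p-1) u_x are the iterated Cauchy product
   uh * (uh * ... (uh * (i<n> uh))) with p-1 factors uh in front.
   A solution u is a total function of which only the restriction to
   [0, L] x R matters; uh t n are its Fourier coefficients, duh t n their
   t-derivatives. *)
Definition classical_qp_solution (R : realType) (p nu : nat)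
    (omega : 'rV[R]_nu) (uh0 : 'rV[int]_nu -> Cplx R) (L : R)
    (u : R -> R -> Cplx R) : Prop :=
  exists uh duh : R -> 'rV[int]_nu -> Cplx R,
  [/\ forall (n : 'rV[int]_nu),
        (forall t : R, 0 <= t <= L ->
           has_derivative_in `[0, L] (uh ^~ n) t (duh t n)) /\
        {within `[0, L], continuous (duh ^~ n)},
      cvg_abs_unif omega L uh u,
      [/\ is_cvg_abs_unif omega L duh,
          is_cvg_abs_unif omega L (fun t n => ifreq omega n * uh t n),
          is_cvg_abs_unif omega L (fun t n => ifreq omega n ^+ 2 * duh t n) &
          is_cvg_abs_unif omega L (fun t =>
            iter p.-1 (cauchy_product (uh t))
              (fun n => ifreq omega n * uh t n))],
      gBBM_on p L u &
      forall x : R, u 0 x = qp_series omega uh0 x].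

Definition lifespan (R : realType) (p nu : nat) (A rho : R) : R :=
  (1 - p%:R^-1) ^+ p.-1 *
  (rho ^+ (p.-1 * nu) / (A * 6%:R ^+ (p.-1 * nu))).

(* Main.v *)
Require Import Defs.
From HB Require Import structures.
From mathcomp Require Import all_boot all_order all_algebra.
From mathcomp Require Import finmap complex.
From mathcomp Require Import all_classical all_reals all_analysis.
From mathcomp Require Import showcase.summability.
From mathcomp Require Import ring lra.

Set Implicit Arguments.
Unset Strict Implicit.
Unset Printing Implicit Defensive.

Import Order.TTheory GRing.Theory Num.Theory.
Import numFieldNormedType.Exports.

Local Open Scope classical_set_scope.
Local Open Scope ring_scope.

(** The Cauchy problem is solved on the side of the Fourier coefficients. There the
    equation reads [u_t = - (1 - d^2)^-1 d (u + u^p / p)], because u^(p-1) u_x is the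
    derivative of u^p / p. The symbol of [(1 - d^2)^-1 d] is [i m(n)] with [m(n)] real
    and [|m(n)| <= 1/2], so this is an ordinary differential equation with a locally
    Lipschitz right-hand side in the algebra of families [a] with
    [sum_n exp (s |n|) |a n|] finite, for convolution. The linear term only
    turns phases and costs nothing ([duhamel_le]).

    Existence. Take [s = rho / 2]. The data have norm at most
    [K = A^(1/(p-1)) (6/rho)^nu] ([data_in_ball]). With [r = K p / (p-1)] the lifespan is
    the time [L] with [L r^(p-1) = 1] ([lifespan_ball_radius]). On the ball of radius
    [r] the nonlinear term has norm at most [r^p / (2p)] and Lipschitz constant at most
    [r^(p-1) / 2]; since [K + L r^p / (2p) <= r] ([ball_radius_stable]) and
    [L r^(p-1) / 2 = 1/2], Picard iteration converges on the whole interval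
    ([coefficient_solution_exists]). The exponential weight makes all the
    differentiated series converge uniformly
    ([classical_solution_of_coefficients]).

    Uniqueness. For an arbitrary classical solution nothing is known about decay.
    Uniform convergence along all finite sets of modes forces uniform smallness of
    the l1 tails ([small_tails_uniform]), which allows termwise
    differentiation. Coefficients of an absolutely convergent series are determined
    by its sum, since the modes are pairwise distinct by rational independence and
    can be cancelled one at a time by averaging two translates
    ([fourier_coefficients_unique]). Hence the coefficients solve the same ordinary
    differential equation ([classical_solution_coefficients]), where a Gronwall
    argument in the unweighted l1 norm applies ([coefficients_unique]). *)

(** * Real-valued modulus *)

Section Modulus.
Variable R : realType.
Implicit Types (x y : R) (z w : Cplx R).

(** The norm of [Cplx R] takes its values in [Cplx R] itself; all estimates are
    made with this real-valued version of it. *)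
Definition modulus z : R := Normc.normc z.
Definition toC x : Cplx R := (x%:C)%C.

Lemma modulusE z : `|z| = toC (modulus z).
Proof. by case: z. Qed.

Lemma modulus_ge0 z : 0 <= modulus z.
Proof. by case: z => a b; exact: sqrtr_ge0. Qed.

Lemma modulus0 : modulus 0 = 0.
Proof. exact: Normc.normc0. Qed.

Lemma modulusM z w : modulus (z * w) = modulus z * modulus w.
Proof. exact: Normc.normcM. Qed.

Lemma modulusN z : modulus (- z) = modulus z.
Proof. exact: normcN. Qed.

Lemma modulusV z : modulus z^-1 = (modulus z)^-1.
Proof. exact: Normc.normcV. Qed.

Lemma modulusD z w : modulus (z + w) <= modulus z + modulus w.
Proof. exact: le_normcD. Qed.

Lemma modulusB z w : modulus (z - w) = modulus (w - z).
Proof. by rewrite -modulusN opprB. Qed.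

Lemma modulus_eq0 z : modulus z = 0 -> z = 0.
Proof. exact: Normc.eq0_normc. Qed.

Lemma toCD x y : toC (x + y) = toC x + toC y.
Proof. exact: rmorphD. Qed.
Lemma toCM x y : toC (x * y) = toC x * toC y.
Proof. exact: rmorphM. Qed.
Lemma toCB x y : toC (x - y) = toC x - toC y.
Proof. exact: rmorphB. Qed.
Lemma toC0 : toC 0 = 0. Proof. by []. Qed.
Lemma toC1 : toC 1 = 1. Proof. by []. Qed.
Lemma toC_nat n : toC n%:R = n%:R.
Proof. exact: (rmorph_nat (real_complex R)). Qed.
Lemma toC_inj : injective toC.
Proof. by move=> x y []. Qed.
Lemma toC_le x y : (toC x <= toC y) = (x <= y).
Proof. exact: lecR. Qed.
Lemma toC_lt x y : (toC x < toC y) = (x < y).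
Proof. exact: ltcR. Qed.
Lemma toC_gt0 z : 0 < z -> exists2 x, 0 < x & z = toC x.
Proof.
case: z => a b; rewrite -[0]/(toC 0); rewrite ltcE /= => /andP[/eqP -> a0].
by exists a.
Qed.

Lemma modulus_toC x : modulus (toC x) = `|x|.
Proof. by rewrite /modulus /toC /= expr0n /= addr0 sqrtr_sqr. Qed.

Lemma modulusX z k : modulus (z ^+ k) = modulus z ^+ k.
Proof.
elim: k => [|k IH]; first by rewrite !expr0 -toC1 modulus_toC normr1.
by rewrite !exprS modulusM IH.
Qed.

Lemma modulus_sum (I : Type) (s : seq I) (f : I -> Cplx R) :
  modulus (\sum_(i <- s) f i) <= \sum_(i <- s) modulus (f i).
Proof.
elim: s => [|i s IH]; first by rewrite !big_nil modulus0.
by rewrite !big_cons (le_trans (modulusD _ _)) // lerD2l.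
Qed.

Lemma modulus_dist z w : `|modulus z - modulus w| <= modulus (z - w).
Proof.
have H a b : modulus a - modulus b <= modulus (a - b).
  by rewrite lerBlDr (le_trans _ (modulusD _ _)) // subrK.
rewrite ler_norml H andbT lerNl opprB modulusB; exact: H.
Qed.

Definition reC z : R := complex.Re z.
Definition imC z : R := complex.Im z.

Lemma reB z w : reC (z - w) = reC z - reC w.
Proof. by case: z; case: w. Qed.
Lemma imB z w : imC (z - w) = imC z - imC w.
Proof. by case: z; case: w. Qed.

Lemma re_le z : `|reC z| <= modulus z.
Proof.
by case: z => a b; rewrite /modulus /= -sqrtr_sqr ler_sqrt ?addr_ge0 ?sqr_ge0 // lerDl sqr_ge0.
Qed.
Lemma im_le z : `|imC z| <= modulus z.
Proof.
by case: z => a b; rewrite /modulus /= -sqrtr_sqr ler_sqrt ?addr_ge0 ?sqr_ge0 // lerDr sqr_ge0.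
Qed.
Lemma modulus_le z : modulus z <= `|reC z| + `|imC z|.
Proof.
case: z => a b; rewrite /modulus /=.
rewrite -(ler_pXn2r (ltn0Sn 1)) ?nnegrE ?addr_ge0 ?sqrtr_ge0 //.
rewrite sqr_sqrtr ?addr_ge0 ?sqr_ge0 // sqrrD !real_normK ?num_real //.
by rewrite lerD2r lerDl mulrn_wge0 // mulr_ge0.
Qed.
End Modulus.
Arguments modulus {R} z.
Arguments toC {R} x.
Arguments reC {R} z.
Arguments imC {R} z.

(** * Unconditional sums of complex families *)

Section UnconditionalSums.
Variable R : realType.

(** Bounding the finite partial sums is how absolute summability enters every
    estimate: such a bound passes through finite exchanges of sums and through
    limits of the terms, and no value of the infinite sum is involved. *)
Definition finite_sums_le (I : choiceType) (g : I -> R) (M : R) : Prop :=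
  forall F : {fset I}, \sum_(i <- F) g i <= M.

Definition sums_to (I : choiceType) (f : I -> Cplx R) (s : Cplx R) : Prop :=
  forall e : R, 0 < e -> exists F0 : {fset I}, forall F : {fset I},
    (F0 `<=` F)%fset -> modulus (\sum_(i <- F) f i - s) <= e.

(** Uniform summability in the parameter: the form of uniform convergence that can
    be stated with moduli, hence is stable under multiplication by characters. *)
Definition small_tails (T : Type) (D : set T) (I : choiceType) (g : T -> I -> R)
  : Prop :=
  forall e : R, 0 < e -> exists F0 : {fset I}, forall (t : T) (G : {fset I}),
    D t -> [disjoint F0 & G]%fset -> \sum_(i <- G) g t i <= e.

Section Basic.
Variable I : choiceType.
Implicit Types (f g : I -> Cplx R) (b c : I -> R) (F G : {fset I}).

Lemma sum_fsetU (V : nmodType) (h : I -> V) F G : [disjoint F & G]%fset ->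
  \sum_(i <- (F `|` G)%fset) h i = \sum_(i <- F) h i + \sum_(i <- G) h i.
Proof.
move=> FG; rewrite (big_fsetID _ (mem F)) /=; congr (_ + _).
  apply: eq_fbigl => i; rewrite !inE /=; by case: (i \in F) => //=; rewrite ?andbF ?andbT.
apply: eq_fbigl => i; rewrite !inE /=.
by case: (boolP (i \in F)) => [/(fdisjointP FG)/negPf ->|] /=; rewrite ?andbT.
Qed.

Lemma sum_fset_split (V : nmodType) (h : I -> V) F G : (F `<=` G)%fset ->
  \sum_(i <- G) h i = \sum_(i <- F) h i + \sum_(i <- (G `\` F)%fset) h i.
Proof.
move=> FG; have {1}-> : G = (F `|` G `\` F)%fset.
  by apply/fsetP => i; rewrite !inE; case: (boolP (i \in F)) => //= /(fsubsetP FG).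
rewrite sum_fsetU //; apply/fdisjointP => i iF; by rewrite !inE iF.
Qed.

Lemma sum_fset_le b F G : (forall i, 0 <= b i) -> (F `<=` G)%fset ->
  \sum_(i <- F) b i <= \sum_(i <- G) b i.
Proof. by move=> b0 /(sum_fset_split b) ->; rewrite lerDl sumr_ge0. Qed.

Lemma sums_to_unique f s t : sums_to f s -> sums_to f t -> s = t.
Proof.
move=> fs ft; apply/eqP; rewrite -subr_eq0; apply/eqP/modulus_eq0/eqP.
rewrite eq_le modulus_ge0 andbT; apply/ler_addgt0Pr => e e0; rewrite add0r.
have [F0 H0] := fs _ (divr_gt0 e0 (ltr0n R 2)).
have [F1 H1] := ft _ (divr_gt0 e0 (ltr0n R 2)).
have := H0 _ (fsubsetUl F0 F1); have := H1 _ (fsubsetUr F0 F1).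
set S := \sum_(i <- _) _ => h1 h0.
have -> : s - t = (S - t) - (S - s) by ring.
by rewrite (le_trans (modulusD _ _)) // modulusN (splitr e) lerD.
Qed.

Lemma sums_to_ext f g s : f =1 g -> sums_to f s -> sums_to g s.
Proof. by move=> /funext ->. Qed.

Lemma sums_toD f g s t : sums_to f s -> sums_to g t ->
  sums_to (fun i => f i + g i) (s + t).
Proof.
move=> fs gt e e0.
have [F0 H0] := fs _ (divr_gt0 e0 (ltr0n R 2)).
have [F1 H1] := gt _ (divr_gt0 e0 (ltr0n R 2)).
exists (F0 `|` F1)%fset => F FF; rewrite big_split /=.
rewrite opprD addrACA (le_trans (modulusD _ _)) // (splitr e) lerD //.
  by apply: H0; apply: fsubset_trans FF; exact: fsubsetUl.
by apply: H1; apply: fsubset_trans FF; exact: fsubsetUr.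
Qed.

Lemma sums_toZ (c : Cplx R) f s : sums_to f s -> sums_to (fun i => c * f i) (c * s).
Proof.
move=> fs e e0.
have c0 : 0 < modulus c + 1 by rewrite ltr_wpDl // modulus_ge0.
have [F0 H0] := fs _ (divr_gt0 e0 c0).
exists F0 => F /H0 H; rewrite -mulr_sumr -mulrBr modulusM.
have := ler_wpM2l (ltW c0) H; rewrite [X in _ <= X]mulrC divfK ?gt_eqF //.
by apply: le_trans; rewrite ler_wpM2r ?modulus_ge0 // lerDl.
Qed.

Lemma sums_toN f s : sums_to f s -> sums_to (fun i => - f i) (- s).
Proof.
move=> /(sums_toZ (-1)); rewrite mulN1r; apply: sums_to_ext => i.
by rewrite mulN1r.
Qed.

Lemma sums_toB f g s t : sums_to f s -> sums_to g t ->
  sums_to (fun i => f i - g i) (s - t).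
Proof. by move=> fs /sums_toN; exact: sums_toD. Qed.

Lemma sums_to0 : sums_to (fun _ : I => 0 : Cplx R) 0.
Proof. by move=> e e0; exists fset0 => F _; rewrite big1 // subr0 modulus0 ltW. Qed.

Lemma finite_sums_le_ge0 b M : finite_sums_le b M -> 0 <= M.
Proof. by move=> /(_ fset0); rewrite big_seq_fset0. Qed.

Lemma finite_sums_le_term b M i : finite_sums_le b M -> b i <= M.
Proof. by move=> /(_ [fset i]%fset); rewrite big_seq_fset1. Qed.

Lemma finite_sums_le_mono b c M N : (forall i, b i <= c i) -> M <= N ->
  finite_sums_le c M -> finite_sums_le b N.
Proof.
by move=> bc MN cM F; apply: le_trans MN; apply: le_trans (cM F); exact: ler_sum.
Qed.

Lemma finite_sums_leD b c M N : finite_sums_le b M -> finite_sums_le c N ->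
  finite_sums_le (fun i => b i + c i) (M + N).
Proof. by move=> bM cN F; rewrite big_split lerD. Qed.

Lemma finite_sums_leZ k b M : 0 <= k -> finite_sums_le b M ->
  finite_sums_le (fun i => k * b i) (k * M).
Proof. by move=> k0 bM F; rewrite -mulr_sumr ler_wpM2l. Qed.

Lemma sums_to_ge0 b M : (forall i, 0 <= b i) -> finite_sums_le b M ->
  exists s : R, sums_to (fun i => toC (b i)) (toC s).
Proof.
move=> b0 bM.
pose S := [set x | exists F : {fset I}, x = \sum_(i <- F) b i].
have hS : has_sup S.
  split; first by exists (\sum_(i <- (fset0 : {fset I})) b i), fset0.
  by exists M => _ [F ->].
exists (sup S) => e e0.
have [_ [F0 ->] HF0] := sup_adherent e0 hS.
exists F0 => F F0F; rewrite -raddf_sum -toCB modulus_toC distrC ger0_norm.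
  rewrite lerBlDr -lerBlDl (le_trans (ltW HF0)) // sum_fset_le //.
by rewrite subr_ge0; apply: sup_upper_bound => //; exists F.
Qed.

(** Completeness enters through suprema of reals: with [h] the real or
    imaginary part, both [`|h|] and [h + `|h|] are nonnegative with bounded sums. *)
Lemma sums_to_exists f M : finite_sums_le (modulus \o f) M ->
  exists s, sums_to f s.
Proof.
move=> fM.
have real (h : I -> R) : (forall i, `|h i| <= modulus (f i)) ->
    exists s : R, sums_to (fun i => toC (h i)) (toC s).
  move=> hf.
  have hM : finite_sums_le (fun i => `|h i|) M by apply: finite_sums_le_mono fM.
  have [s hs] := sums_to_ge0 (fun i => normr_ge0 (h i)) hM.
  have [t ht] : exists t, sums_to (fun i => toC (h i + `|h i|)) (toC t).
    apply: (@sums_to_ge0 _ (M + M)) => [i|].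
      by have := ler_norm (- h i); rewrite normrN => ?; lra.
    apply: finite_sums_leD => //; apply: finite_sums_le_mono hM => // i.
    exact: ler_norm.
  exists (t - s); rewrite toCB; have := sums_toB ht hs; apply: sums_to_ext => i.
  by rewrite -toCB addrK.
have [a ha] := real (reC \o f) (fun i => re_le _).
have [b hb] := real (imC \o f) (fun i => im_le _).
exists (toC a + ('i)%C * toC b); have := sums_toD ha (sums_toZ ('i)%C hb).
by apply: sums_to_ext => i; rewrite /= -complexE.
Qed.

(** Otherwise the partial sum over a set close to the supremum could be increased
    by more than what is left. *)
Lemma finite_sums_le_tail b M : (forall i, 0 <= b i) -> finite_sums_le b M ->
  forall e, 0 < e -> exists F0 : {fset I}, forall G : {fset I},
    [disjoint F0 & G]%fset -> \sum_(i <- G) b i <= e.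
Proof.
move=> b0 bM e e0; have [s hs] := sums_to_ge0 b0 bM.
have [F0 H] := hs _ (divr_gt0 e0 (ltr0n R 2)).
exists F0 => G FG; have h0 := H _ (fsubset_refl F0).
have h1 := H _ (fsubsetUl F0 G).
move: h0 h1; rewrite -!raddf_sum -!toCB !modulus_toC sum_fsetU //.
rewrite !ler_norml => /andP[h1 _] /andP[_ h2]; lra.
Qed.

(** Quantitative form of convergence: the remainder beyond [F0] is controlled by
    the absolute sums off [F0]. *)
Lemma sums_to_remainder f s F0 e : sums_to f s ->
  (forall G, [disjoint F0 & G]%fset -> \sum_(i <- G) modulus (f i) <= e) ->
  forall F, (F0 `<=` F)%fset -> modulus (\sum_(i <- F) f i - s) <= e.
Proof.
move=> fs H F F0F; apply/ler_addgt0Pr => d d0; have [F1 H1] := fs d d0.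
have := H1 _ (fsubsetUr F F1); rewrite (sum_fset_split _ (fsubsetUl F F1)).
set A := \sum_(i <- F) _; set B := \sum_(i <- _) _ => h.
have -> : A - s = (A + B - s) - B by ring.
rewrite (le_trans (modulusD _ _)) // modulusN addrC lerD //.
apply: le_trans (modulus_sum _ _) (H _ _).
apply/fdisjointP => i /(fsubsetP F0F) iF; by rewrite !inE iF.
Qed.

Lemma sums_to_reindex (J : choiceType) (phi : J -> I) (psi : I -> J) f s :
  cancel phi psi -> cancel psi phi -> sums_to f s -> sums_to (f \o phi) s.
Proof.
move=> phiK psiK fs e e0; have [F0 H] := fs e e0.
exists (psi @` F0)%fset => F FF.
suff -> : \sum_(i <- F) (f \o phi) i = \sum_(i <- (phi @` F)%fset) f i.
  apply: H; apply/fsubsetP => i iF0; apply/imfsetP; exists (psi i) => //=.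
  by apply: (fsubsetP FF); exact: in_imfset.
by rewrite big_imfset //= => x y _ _; exact: (can_inj phiK).
Qed.

Lemma finite_sums_le_reindex (J : choiceType) (phi : J -> I) b M :
  injective phi -> finite_sums_le b M -> finite_sums_le (b \o phi) M.
Proof.
move=> inj bM F; have := bM (phi @` F)%fset.
by rewrite big_imfset //= => x y _ _; exact: inj.
Qed.

End Basic.
End UnconditionalSums.

Section DoubleSums.
Variable R : realType.

Lemma sum_fsetM (V : nmodType) (I J : choiceType) (A : {fset I}) (B : {fset J})
    (g : I * J -> V) :
  \sum_(p <- (A `*` B)%fset) g p = \sum_(i <- A) \sum_(j <- B) g (i, j).
Proof. by rewrite big_imfset2 //= => -[? ?] [? ?] _ _ /= [-> ->]. Qed.

Lemma fsubset_fsetM (I J : choiceType) (F : {fset I * J}) :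
  (F `<=` (fst @` F) `*` (snd @` F))%fset.
Proof.
by apply/fsubsetP => p pF; rewrite in_fsetM !in_imfset.
Qed.

Lemma finite_sums_le_iterated (I J : choiceType) (g : I * J -> R) (b : I -> R) M :
  (forall p, 0 <= g p) -> (forall i, finite_sums_le (fun j => g (i, j)) (b i)) ->
  finite_sums_le b M -> finite_sums_le g M.
Proof.
move=> g0 gb bM F; apply: le_trans (sum_fset_le g0 (fsubset_fsetM F)) _.
by rewrite sum_fsetM; apply: le_trans (bM (fst @` F)%fset); apply: ler_sum => i _; exact: gb.
Qed.

Lemma finite_sums_leM (I J : choiceType) (b : I -> R) (c : J -> R) M N :
  (forall i, 0 <= b i) -> (forall j, 0 <= c j) ->
  finite_sums_le b M -> finite_sums_le c N ->
  finite_sums_le (fun p => b p.1 * c p.2) (M * N).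
Proof.
move=> b0 c0 bM cN; apply: (@finite_sums_le_iterated _ _ _ (fun i => b i * N)).
- by move=> p; exact: mulr_ge0.
- by move=> i /=; exact: finite_sums_leZ.
move=> F; rewrite -mulr_suml ler_wpM2r //; exact: finite_sums_le_ge0 cN.
Qed.

(** Finitely many convergent sums can be truncated at the same place, which is what
    exchanging a finite sum with an infinite one needs. *)
Lemma sums_to_joint (I J : choiceType) (f : I -> J -> Cplx R) (h : I -> Cplx R) :
  (forall i, sums_to (f i) (h i)) -> forall (s : seq I) (e : R), 0 < e ->
  exists B0 : {fset J}, forall B : {fset J}, (B0 `<=` B)%fset ->
    forall i, i \in s -> modulus (\sum_(j <- B) f i j - h i) <= e.
Proof.
move=> fh s e e0; elim: s => [|i s [B1 H1]]; first by exists fset0.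
have [B2 H2] := fh i e e0; exists (B1 `|` B2)%fset => B BB k.
rewrite inE => /predU1P[->|ks].
  by apply: H2; apply: fsubset_trans BB; exact: fsubsetUr.
by apply: H1 => //; apply: fsubset_trans BB; exact: fsubsetUl.
Qed.

(** Fubini: a rectangle large enough to contain the projections of the finite set
    carrying almost all of the double sum computes both sides. *)
Lemma sums_to_iterated (I J : choiceType) (f : I * J -> Cplx R) (h : I -> Cplx R)
    M s :
  finite_sums_le (modulus \o f) M -> sums_to f s ->
  (forall i, sums_to (fun j => f (i, j)) (h i)) -> sums_to h s.
Proof.
move=> fM fs fh e e0.
have [F0 H0] := finite_sums_le_tail (fun p => modulus_ge0 (f p)) fM e0.
exists (fst @` F0)%fset => F FF; apply/ler_addgt0Pr => d d0.
have c0 : 0 < (size F)%:R + 1 :> R by rewrite ltr_wpDl.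
have [B0 HB] := sums_to_joint fh F (divr_gt0 d0 c0).
pose B := (B0 `|` snd @` F0)%fset.
have h1 : modulus (\sum_(p <- (F `*` B)%fset) f p - s) <= e.
  apply: (sums_to_remainder fs H0); apply: fsubset_trans (fsubset_fsetM F0) _.
  apply/fsubsetP => p; rewrite !in_fsetM => /andP[p1 p2].
  by rewrite (fsubsetP FF) //= /B in_fsetU p2 orbT.
have h2 : modulus (\sum_(i <- F) h i - \sum_(p <- (F `*` B)%fset) f p) <= d.
  rewrite sum_fsetM -sumrB (le_trans (modulus_sum _ _)) //.
  apply: (@le_trans _ _ (\sum_(i <- F) d / ((size F)%:R + 1))).
    rewrite big_seq [leRHS]big_seq; apply: ler_sum => i iF; rewrite modulusB.
    by apply: HB => //; exact: fsubsetUl.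
  rewrite big_const_seq count_predT iter_addr_0 -[leLHS]mulr_natr -mulrA.
  by rewrite ler_piMr ?(ltW d0) // mulrC ler_pdivrMr // mul1r lerDl.
set S := \sum_(i <- _) _; set T := \sum_(i <- _) _ in h1 h2 *.
have -> : S - s = (T - s) + (S - T) by ring.
by rewrite (le_trans (modulusD _ _)) // lerD.
Qed.

(** Summing the inner variable first does not increase weighted absolute sums; this
    is the estimate behind the Banach algebra property of convolution. *)
Lemma finite_sums_le_inner (I J : choiceType) (f : I * J -> Cplx R)
    (h : I -> Cplx R) (w : I -> R) M :
  (forall i, 0 <= w i) ->
  finite_sums_le (fun p => w p.1 * modulus (f p)) M ->
  (forall i, sums_to (fun j => f (i, j)) (h i)) ->
  finite_sums_le (fun i => w i * modulus (h i)) M.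
Proof.
move=> w0 fM fh F; apply/ler_addgt0Pr => d d0.
have W0 : 0 <= \sum_(i <- F) w i by exact: sumr_ge0.
have c0 : 0 < \sum_(i <- F) w i + 1 by rewrite ltr_wpDl.
have [B HB] := sums_to_joint fh F (divr_gt0 d0 c0).
apply: (@le_trans _ _ (\sum_(i <- F) w i * (\sum_(j <- B) modulus (f (i, j))
   + d / (\sum_(i <- F) w i + 1)))).
  rewrite big_seq [leRHS]big_seq; apply: ler_sum => i iF; rewrite ler_wpM2l //.
  have -> : h i = \sum_(j <- B) f (i, j) - (\sum_(j <- B) f (i, j) - h i) by ring.
  by rewrite (le_trans (modulusD _ _)) // modulusN lerD ?modulus_sum ?HB.
under eq_bigr do rewrite mulrDr.
rewrite big_split lerD //=.
  have := fM (F `*` B)%fset; rewrite sum_fsetM /=; apply: le_trans.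
  by apply: ler_sum => i _; rewrite mulr_sumr.
by rewrite -mulr_suml mulrCA ler_piMr ?(ltW d0) // ler_pdivrMr // mul1r lerDl.
Qed.

(** The double family has a sum by absolute summability, and summing its rows first
    identifies that sum with the product. *)
Lemma sums_toM (I J : choiceType) (f : I -> Cplx R) (g : J -> Cplx R) M N s t :
  finite_sums_le (modulus \o f) M -> finite_sums_le (modulus \o g) N ->
  sums_to f s -> sums_to g t -> sums_to (fun p => f p.1 * g p.2) (s * t).
Proof.
move=> fM gN fs gt.
have fgMN : finite_sums_le (modulus \o (fun p : I * J => f p.1 * g p.2)) (M * N).
  have := finite_sums_leM (fun i => modulus_ge0 (f i)) (fun i => modulus_ge0 (g i)) fM gN.
  by apply: finite_sums_le_mono => // p /=; rewrite modulusM.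
have [S hS] := sums_to_exists fgMN.
suff <- : S = s * t by [].
apply: (@sums_to_unique _ _ (fun i => f i * t)).
  apply: (sums_to_iterated fgMN hS) => i /=; exact: sums_toZ.
by rewrite mulrC; have := sums_toZ t fs; apply: sums_to_ext => i; rewrite mulrC.
Qed.

End DoubleSums.

#[local] Existing Instance totally_filter.

Section LibrarySums.
Variable R : realType.

(** Ties the epsilon form to limits along finite subsets, by which the sums of the
    theorem are defined. *)
Lemma sums_to_cvg (I : choiceType) (f : I -> Cplx R) s :
  sums_to f s <-> (partial_sum f @ totally --> s).
Proof.
have psE F : partial_sum f F = \sum_(i <- F) f i.
  by rewrite /partial_sum big_seq_fsetE.
split=> [fs|/cvgrPdist_le fs e e0].
  apply/cvgrPdist_le => z /toC_gt0[e e0 ->].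
  have [F0 H] := fs e e0; exists F0 => // F F0F /=.
  by rewrite psE modulusE toC_le modulusB H.
have := fs (toC e); rewrite -toC0 toC_lt => /(_ e0)[F0 _ H].
by exists F0 => F /H /=; rewrite psE modulusE toC_le modulusB.
Qed.

Lemma sums_to_sum (I : choiceType) (f : I -> Cplx R) s :
  sums_to f s -> summability.sum f = s.
Proof. by move=> /sums_to_cvg fs; apply: cvg_lim => //; exact: norm_hausdorff. Qed.
End LibrarySums.

(** * The weighted convolution algebra *)

Section Convolution.
Variables (R : realType) (nu : nat).
Local Notation Z := 'rV[int]_nu.
Implicit Types (a b : Z -> Cplx R) (W : Z -> R) (e : Z -> Cplx R) (M N : R).

Definition weighted_l1_le W a M := finite_sums_le (fun n => W n * modulus (a n)) M.

Definition submultiplicative_weight W :=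
  (forall n, 1 <= W n) /\ forall m n, W (m + n) <= W m * W n.

Definition unitary_character e :=
  (forall n, modulus (e n) = 1) /\ forall m n, e (m + n) = e m * e n.

(* Convolution is pushing the product family forward along addition: these are
   the two inverse changes of variables. *)
Let shear (p : Z * Z) : Z * Z := (p.1 - p.2, p.2).
Let unshear (p : Z * Z) : Z * Z := (p.1 + p.2, p.2).

Let shearK : cancel shear unshear.
Proof. by case=> n m; rewrite /shear /unshear /= subrK. Qed.
Let unshearK : cancel unshear shear.
Proof. by case=> n m; rewrite /shear /unshear /= addrK. Qed.

Lemma weight_ge0 W : submultiplicative_weight W -> forall n, 0 <= W n.
Proof. by move=> [W1 _] n; exact: le_trans (W1 n). Qed.

Lemma weighted_l1_le_modulus W a M : submultiplicative_weight W ->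
  weighted_l1_le W a M -> finite_sums_le (modulus \o a) M.
Proof.
move=> [W1 _]; apply: finite_sums_le_mono => // n.
by rewrite /= ler_peMl ?modulus_ge0.
Qed.

Lemma weighted_l1_leN W a M : weighted_l1_le W a M ->
  weighted_l1_le W (fun n => - a n) M.
Proof. by apply: finite_sums_le_mono => // n; rewrite modulusN. Qed.

Lemma weighted_l1_leD W a b M N : (forall n, 0 <= W n) ->
  weighted_l1_le W a M -> weighted_l1_le W b N ->
  weighted_l1_le W (fun n => a n + b n) (M + N).
Proof.
move=> W0 aM bN; have := finite_sums_leD aM bN; apply: finite_sums_le_mono => // n.
by rewrite -mulrDr ler_wpM2l // modulusD.
Qed.

Lemma conv_sums_to a b M N n : finite_sums_le (modulus \o a) M ->
  finite_sums_le (modulus \o b) N ->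
  sums_to (fun m => a (n - m) * b m) (cauchy_product a b n).
Proof.
move=> aM bN.
have [s hs] : exists s, sums_to (fun m => a (n - m) * b m) s.
  apply: (@sums_to_exists _ _ _ (M * N)).
  have := finite_sums_leZ (finite_sums_le_ge0 aM) bN.
  apply: finite_sums_le_mono => // m /=; rewrite modulusM ler_wpM2r ?modulus_ge0 //.
  exact: (finite_sums_le_term (n - m) aM).
by rewrite /cauchy_product (sums_to_sum hs).
Qed.

(** After the shear [(n, m) |-> (n - m, m)] the double family is a product. *)
Lemma conv_pairs_le W a b M N : submultiplicative_weight W ->
  weighted_l1_le W a M -> weighted_l1_le W b N ->
  finite_sums_le (fun p : Z * Z => W p.1 * modulus (a (p.1 - p.2) * b p.2)) (M * N).
Proof.
move=> Wsub aM bN; have W0 := weight_ge0 Wsub.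
have H := finite_sums_leM (fun n => mulr_ge0 (W0 n) (modulus_ge0 (a n)))
  (fun n => mulr_ge0 (W0 n) (modulus_ge0 (b n))) aM bN.
have := finite_sums_le_reindex (can_inj shearK) H.
apply: finite_sums_le_mono => // -[n m] /=.
rewrite modulusM mulrACA ler_wpM2r ?mulr_ge0 ?modulus_ge0 //.
by have := Wsub.2 (n - m) m; rewrite subrK.
Qed.

Lemma conv_weighted_l1_le W a b M N : submultiplicative_weight W ->
  weighted_l1_le W a M -> weighted_l1_le W b N ->
  weighted_l1_le W (cauchy_product a b) (M * N).
Proof.
move=> Wsub aM bN.
apply: (finite_sums_le_inner (weight_ge0 Wsub) (conv_pairs_le Wsub aM bN)) => n /=.
by apply: conv_sums_to; apply: weighted_l1_le_modulus; eassumption.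
Qed.

Lemma unit_weight : submultiplicative_weight (fun=> 1).
Proof. by split=> // m n; rewrite mulr1. Qed.

Lemma unit_weighted a M : finite_sums_le (modulus \o a) M ->
  weighted_l1_le (fun=> 1) a M.
Proof. by apply: finite_sums_le_mono => // n; rewrite mul1r. Qed.

(** The Fourier transform at a character is multiplicative: shear the product of
    the two series and sum along the fibres. *)
Lemma conv_character a b e s t M N : unitary_character e ->
  finite_sums_le (modulus \o a) M -> finite_sums_le (modulus \o b) N ->
  sums_to (fun n => a n * e n) s -> sums_to (fun n => b n * e n) t ->
  sums_to (fun n => cauchy_product a b n * e n) (s * t).
Proof.
move=> [e1 eD] aM bN hs ht.
have em c : modulus \o (fun n => c n * e n) = modulus \o c.
  by apply/funext => n /=; rewrite modulusM e1 mulr1.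
have := sums_toM _ _ hs ht; rewrite !em => /(_ _ _ aM bN).
move=> /(sums_to_reindex shearK unshearK) hst.
pose F p : Cplx R := a (p.1 - p.2) * b p.2 * e p.1.
have FE : F =1 (fun p => a p.1 * e p.1 * (b p.2 * e p.2)) \o shear.
  case=> n m; rewrite /F /=; have -> : e n = e (n - m) * e m by rewrite -eD subrK.
  by ring.
have FM : finite_sums_le (modulus \o F) (M * N).
  have := conv_pairs_le unit_weight (unit_weighted aM) (unit_weighted bN).
  by apply: finite_sums_le_mono => // p; rewrite /F /= modulusM e1 mulr1 mul1r.
apply: (sums_to_iterated FM).
  by apply: sums_to_ext hst => p; rewrite FE.
move=> n; rewrite mulrC.
have := sums_toZ (e n) (conv_sums_to n aM bN).
by apply: sums_to_ext => m; rewrite /F /= mulrC.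
Qed.

Lemma convB a a' b b' M n :
  finite_sums_le (modulus \o a) M -> finite_sums_le (modulus \o a') M ->
  finite_sums_le (modulus \o b) M -> finite_sums_le (modulus \o b') M ->
  cauchy_product a b n - cauchy_product a' b' n =
  cauchy_product a (fun m => b m - b' m) n +
  cauchy_product (fun m => a m - a' m) b' n.
Proof.
move=> aM a'M bM b'M.
have BM (c d : Z -> Cplx R) : finite_sums_le (modulus \o c) M -> finite_sums_le (modulus \o d) M ->
    finite_sums_le (modulus \o (fun m => c m - d m)) (M + M).
  move=> cM dM; have := finite_sums_leD cM dM; apply: finite_sums_le_mono => // m /=.
  by rewrite (le_trans (modulusD _ _)) // modulusN.
have h1 := sums_toB (conv_sums_to n aM bM) (conv_sums_to n a'M b'M).
have h2 := sums_toD (conv_sums_to n aM (BM _ _ bM b'M))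
  (conv_sums_to n (BM _ _ aM a'M) b'M).
apply: (sums_to_unique h1); apply: sums_to_ext h2 => m; ring.
Qed.

Lemma conv_iter_weighted_l1_le W a b M N k : submultiplicative_weight W ->
  weighted_l1_le W a M -> weighted_l1_le W b N ->
  weighted_l1_le W (iter k (cauchy_product a) b) (M ^+ k * N).
Proof.
move=> Wsub aM bN; elim: k => [|k IH]; first by rewrite mul1r.
by rewrite exprS -mulrA; exact: conv_weighted_l1_le.
Qed.

Lemma conv_iter_character a b e s t M N k : unitary_character e ->
  finite_sums_le (modulus \o a) M -> finite_sums_le (modulus \o b) N ->
  sums_to (fun n => a n * e n) s -> sums_to (fun n => b n * e n) t ->
  sums_to (fun n => iter k (cauchy_product a) b n * e n) (s ^+ k * t).
Proof.
move=> he aM bN hs ht; elim: k => [|k IH]; first by rewrite mul1r.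
rewrite exprS -mulrA; apply: (conv_character he aM _ hs IH).
apply: weighted_l1_le_modulus unit_weight _.
by apply: conv_iter_weighted_l1_le unit_weight _ _; exact: unit_weighted.
Qed.

(** Telescoping [a^k - b^k] in a Banach algebra gives the factor [(k + 1) r^k]; with
    [k + 1 = p] this factor cancels the [1/p] of the equation. *)
Lemma conv_iter_lipschitz W a b r d k : submultiplicative_weight W ->
  weighted_l1_le W a r -> weighted_l1_le W b r ->
  weighted_l1_le W (fun n => a n - b n) d ->
  weighted_l1_le W (fun n => iter k (cauchy_product a) a n
                             - iter k (cauchy_product b) b n)
    (k.+1%:R * r ^+ k * d).
Proof.
move=> Wsub ar br abd; elim: k => [|k IH]; first by rewrite expr0 !mul1r.
have W0 := weight_ge0 Wsub.
have h1 := conv_weighted_l1_le Wsub ar IH.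
have h2 := conv_weighted_l1_le Wsub abd (conv_iter_weighted_l1_le k Wsub br br).
have ia := conv_iter_weighted_l1_le k Wsub ar ar.
have ib := conv_iter_weighted_l1_le k Wsub br br.
have r0 : 0 <= r by exact: finite_sums_le_ge0 ar.
have := weighted_l1_leD W0 h1 h2.
have -> : r * (k.+1%:R * r ^+ k * d) + d * (r ^+ k * r) = k.+2%:R * r ^+ k.+1 * d.
  by rewrite exprS -[k.+2%:R]natr1; ring.
apply: finite_sums_le_mono => // n; rewrite ler_wpM2l //=.
have rr : 0 <= r ^+ k * r by rewrite mulr_ge0 ?exprn_ge0.
have L c N N' : weighted_l1_le W c N -> N <= N' ->
    finite_sums_le (modulus \o c) N'.
  by move=> /(weighted_l1_le_modulus Wsub) + NN'; exact: finite_sums_le_mono.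
have l1 : r <= r + r ^+ k * r by rewrite lerDl.
have l2 : r ^+ k * r <= r + r ^+ k * r by rewrite lerDr.
by rewrite (convB _ (L _ _ _ ar l1) (L _ _ _ br l1) (L _ _ _ ia l2) (L _ _ _ ib l2)).
Qed.

End Convolution.

(** * Derivatives of complex functions relative to a set *)

Section Derivatives.
Variable R : realType.
Implicit Types (D : set R) (f g : R -> Cplx R) (t s x : R) (l k : Cplx R).

(** First-order expansion with error relative to [D], free of quotients; one-sided
    derivatives at end points and two-sided ones are treated together. *)
Definition derivative_at D f t l := forall e : R, 0 < e -> exists2 d : R, 0 < d &
  forall s, D s -> `|s - t| < d ->
    modulus (f s - f t - l * toC (s - t)) <= e * `|s - t|.

Definition continuous_on_at D f t := forall e : R, 0 < e -> exists2 d : R, 0 < d &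
  forall s, D s -> `|s - t| < d -> modulus (f s - f t) <= e.

Lemma derivative_at_continuous D f t l :
  derivative_at D f t l -> continuous_on_at D f t.
Proof.
move=> df e e0; have [d d0 H] := df 1 ltr01.
have m0 : 0 < modulus l + 1 by rewrite ltr_wpDl // modulus_ge0.
exists (Num.min d (e / (modulus l + 1))); first by rewrite lt_min d0 divr_gt0.
move=> s Ds; rewrite lt_min => /andP[/(H s Ds) h]; rewrite ltr_pdivlMr // => he.
have -> : f s - f t = (f s - f t - l * toC (s - t)) + l * toC (s - t) by ring.
rewrite (le_trans (modulusD _ _)) // modulusM modulus_toC (le_trans _ (ltW he)) //.
lra.
Qed.

Lemma derivative_at_ext D f g t l : (forall s, D s -> f s = g s) -> D t ->
  derivative_at D f t l -> derivative_at D g t l.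
Proof.
move=> fg Dt df e /df[d d0 H]; exists d => // s Ds /(H _ Ds).
by rewrite !fg.
Qed.

Lemma derivative_at_cst D k t : derivative_at D (fun=> k) t 0.
Proof.
move=> e e0; exists 1 => // s _ _; rewrite subrr mul0r subr0 modulus0.
by rewrite mulr_ge0 // ltW.
Qed.

Lemma derivative_atD D f g t k l : derivative_at D f t k -> derivative_at D g t l ->
  derivative_at D (fun s => f s + g s) t (k + l).
Proof.
move=> df dg e e0.
have [d1 d10 H1] := df _ (divr_gt0 e0 (ltr0n R 2)).
have [d2 d20 H2] := dg _ (divr_gt0 e0 (ltr0n R 2)).
exists (Num.min d1 d2); first by rewrite lt_min d10.
move=> s Ds; rewrite lt_min => /andP[/(H1 s Ds) h1 /(H2 s Ds) h2].
have -> : f s + g s - (f t + g t) - (k + l) * toC (s - t) =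
  (f s - f t - k * toC (s - t)) + (g s - g t - l * toC (s - t)) by ring.
rewrite (le_trans (modulusD _ _)) //; lra.
Qed.

Lemma derivative_atM D f g t k l : derivative_at D f t k -> derivative_at D g t l ->
  derivative_at D (fun s => f s * g s) t (k * g t + f t * l).
Proof.
move=> df dg e e0.
pose K := modulus (g t) + modulus (f t) + modulus k + 1.
have K0 : 0 < K by rewrite /K ltr_wpDl // !addr_ge0 // modulus_ge0.
(* The error splits into three terms, each at most (e / (3 K)) K |s - t|. *)
have eK0 : 0 < e / (3 * K) by rewrite divr_gt0 // mulr_gt0.
have [d1 d10 H1] := df _ eK0.
have [d2 d20 H2] := dg _ eK0.
have m0 : 0 < Num.min 1 (e / (3 * K)) by rewrite lt_min ltr01.
have [d3 d30 H3] := derivative_at_continuous dg m0.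
exists (Num.min d1 (Num.min d2 d3)); first by rewrite !lt_min d10 d20.
move=> s Ds; rewrite !lt_min => /and3P[/(H1 s Ds) h1 /(H2 s Ds) h2 /(H3 s Ds)].
rewrite le_min => /andP[h3 h4].
set T := toC (s - t) in h1 h2 *.
have -> : f s * g s - f t * g t - (k * g t + f t * l) * T =
  (f s - f t - k * T) * (g t + (g s - g t)) + f t * (g s - g t - l * T)
   + (g s - g t) * (k * T) by ring.
rewrite (le_trans (modulusD _ _)) // (le_trans (lerD (modulusD _ _) (lexx _))) //.
rewrite !modulusM.
have hT : modulus T = `|s - t| by rewrite modulus_toC.
have hg : modulus (g t + (g s - g t)) <= modulus (g t) + 1.
  by rewrite (le_trans (modulusD _ _)) // lerD2l.
rewrite hT.
set E := e / (3 * K) in h1 h2 h4 *; set A := `|s - t| in h1 h2 *.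
have A0 : 0 <= A by exact: normr_ge0.
have hE : E * K = e / 3 by rewrite /E; field; rewrite gt_eqF.
have gt0 := modulus_ge0 (g t); have ft0 := modulus_ge0 (f t).
have k0 := modulus_ge0 k.
have b1 : modulus (f s - f t - k * T) * modulus (g t + (g s - g t)) <= E * A * K.
  apply: ler_pM; rewrite ?modulus_ge0 // (le_trans hg) // /K; lra.
have b2 : modulus (f t) * modulus (g s - g t - l * T) <= K * (E * A).
  apply: ler_pM; rewrite ?modulus_ge0 // /K; lra.
have b3 : modulus (g s - g t) * (modulus k * A) <= E * (K * A).
  apply: ler_pM; rewrite ?mulr_ge0 ?modulus_ge0 // ler_wpM2r // /K; lra.
have -> : e * A = E * A * K + K * (E * A) + E * (K * A).
  have -> : E * A * K + K * (E * A) + E * (K * A) = 3 * (E * K) * A by ring.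
  by rewrite hE; field.
by rewrite !lerD.
Qed.

Lemma derivative_atZ D f t k l : derivative_at D f t l ->
  derivative_at D (fun s => k * f s) t (k * l).
Proof.
move=> df; have := derivative_atM (derivative_at_cst D k t) df.
by rewrite mul0r add0r.
Qed.

Lemma derivative_atB D f g t k l : derivative_at D f t k -> derivative_at D g t l ->
  derivative_at D (fun s => f s - g s) t (k - l).
Proof.
move=> df /(derivative_atZ (-1)) dg; have := derivative_atD df dg.
by rewrite mulN1r; under eq_fun do rewrite mulN1r.
Qed.

Lemma derivative_atX D f t l m : derivative_at D f t l ->
  derivative_at D (fun s => f s ^+ m.+1) t (m.+1%:R * (f t ^+ m * l)).
Proof.
move=> df; elim: m => [|m IH]; first by rewrite expr0 !mul1r.
have := derivative_atM df IH; under eq_fun do rewrite -exprS.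
by congr derivative_at; rewrite -[m.+2%:R]natr1 !exprS; ring.
Qed.

Lemma derivative_at_unique D f t k l :
  (forall d, 0 < d -> exists s, [/\ D s, s != t & `|s - t| < d]) ->
  derivative_at D f t k -> derivative_at D f t l -> k = l.
Proof.
move=> Dt dk dl; apply/eqP; rewrite -subr_eq0; apply/eqP/modulus_eq0/eqP.
rewrite eq_le modulus_ge0 andbT; apply/ler_addgt0Pr => e e0; rewrite add0r.
have [d1 d10 H1] := dk _ (divr_gt0 e0 (ltr0n R 2)).
have [d2 d20 H2] := dl _ (divr_gt0 e0 (ltr0n R 2)).
have m0 : 0 < Num.min d1 d2 by rewrite lt_min d10.
have [s [Ds st]] := Dt _ m0; rewrite lt_min => /andP[/(H1 s Ds) h1 /(H2 s Ds) h2].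
have st0 : 0 < `|s - t| by rewrite normr_gt0 subr_eq0.
rewrite -(ler_pM2r st0) -{1}(modulus_toC (s - t)) -modulusM.
have -> : (k - l) * toC (s - t) =
  (f s - f t - l * toC (s - t)) - (f s - f t - k * toC (s - t)) by ring.
rewrite (le_trans (modulusD _ _)) // modulusN; lra.
Qed.

(** Restricts a derivative to the segment from [x] to [x + k], so that statements
    on a time interval starting at 0 apply to arbitrary segments. *)
Lemma derivative_at_affine D D' f t x (k : R) l :
  (forall s, D' s -> D (x + s * k)) ->
  derivative_at D f (x + t * k) l ->
  derivative_at D' (fun s => f (x + s * k)) t (l * toC k).
Proof.
move=> DD df e e0.
have k0 : 0 < `|k| + 1 by rewrite ltr_wpDl.
have [d d0 H] := df _ (divr_gt0 e0 k0).
exists (d / (`|k| + 1)); first by rewrite divr_gt0.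
move=> s D's; rewrite ltr_pdivlMr // => hs.
have E : x + s * k - (x + t * k) = (s - t) * k by ring.
have := H _ (DD _ D's); rewrite E normrM.
have hk : `|s - t| * `|k| <= `|s - t| * (`|k| + 1) by rewrite ler_wpM2l // lerDl.
move=> /(_ (le_lt_trans hk hs)); rewrite toCM [toC _ * _]mulrC mulrA.
move/le_trans; apply; rewrite mulrAC ler_pdivrMr // -[leRHS]mulrA.
by rewrite ler_wpM2l ?(ltW e0).
Qed.

Lemma derivative_at_sum D (I : Type) (r : seq I) (F : R -> I -> Cplx R) t
    (G : I -> Cplx R) :
  (forall i, derivative_at D (F^~ i) t (G i)) ->
  derivative_at D (fun s => \sum_(i <- r) F s i) t (\sum_(i <- r) G i).
Proof.
move=> FG; elim: r => [|i r IH].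
  by under eq_fun do rewrite big_nil; rewrite big_nil; exact: derivative_at_cst.
under eq_fun do rewrite big_cons; rewrite big_cons; exact: derivative_atD.
Qed.

Lemma continuous_on_at_cst D (k : Cplx R) t : continuous_on_at D (fun=> k) t.
Proof. exact: derivative_at_continuous (derivative_at_cst _ _ _). Qed.

Lemma continuous_on_atD D (f g : R -> Cplx R) t : continuous_on_at D f t ->
  continuous_on_at D g t -> continuous_on_at D (fun s => f s + g s) t.
Proof.
move=> cf cg e e0; have e20 : 0 < e / 2 by rewrite divr_gt0.
have [d1 d10 H1] := cf _ e20; have [d2 d20 H2] := cg _ e20.
exists (Num.min d1 d2); first by rewrite lt_min d10.
move=> s Ds; rewrite lt_min => /andP[/(H1 s Ds) h1 /(H2 s Ds) h2].
by rewrite opprD addrACA (le_trans (modulusD _ _)) // (splitr e) lerD.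
Qed.

Lemma continuous_on_atM D (f g : R -> Cplx R) t : continuous_on_at D f t ->
  continuous_on_at D g t -> continuous_on_at D (fun s => f s * g s) t.
Proof.
move=> cf cg e e0.
pose K := modulus (f t) + modulus (g t) + 1.
have K0 : 0 < K by rewrite ltr_wpDl // addr_ge0 // modulus_ge0.
pose e1 := Num.min 1 (e / K).
have e10 : 0 < e1 by rewrite lt_min ltr01 divr_gt0.
have [d1 d10 H1] := cf _ e10; have [d2 d20 H2] := cg _ e10.
exists (Num.min d1 d2); first by rewrite lt_min d10.
move=> s Ds; rewrite lt_min => /andP[/(H1 s Ds) h1 /(H2 s Ds) h2].
have -> : f s * g s - f t * g t =
  (f s - f t) * (g s - g t) + f t * (g s - g t) + (f s - f t) * g t by ring.
rewrite (le_trans (modulusD _ _)) // (le_trans (lerD (modulusD _ _) (lexx _))) //.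
rewrite !modulusM.
have e1K : e1 * K <= e by rewrite -ler_pdivlMr // ge_min lexx orbT.
have e11 : e1 <= 1 by rewrite ge_min lexx.
apply: le_trans e1K; rewrite /K !mulrDr mulr1.
have b1 : modulus (f s - f t) * modulus (g s - g t) <= e1.
  rewrite -[leRHS]mulr1; apply: ler_pM; rewrite ?modulus_ge0 //; exact: le_trans e11.
have b2 : modulus (f t) * modulus (g s - g t) <= e1 * modulus (f t).
  by rewrite mulrC ler_wpM2r // modulus_ge0.
have b3 : modulus (f s - f t) * modulus (g t) <= e1 * modulus (g t).
  by rewrite ler_wpM2r // modulus_ge0.
lra.
Qed.

End Derivatives.

Section RealDerivatives.
Variable R : realType.
Implicit Types (f : R -> R) (x t s l : R).

Lemma is_derive_expansion f x l : is_derive x 1 f l ->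
  forall e, 0 < e -> exists2 d : R, 0 < d &
    forall s, `|s - x| < d -> `|f s - f x - l * (s - x)| <= e * `|s - x|.
Proof.
move=> [df fl] e e0.
have : h^-1 *: (f (h *: 1 + x) - f x) @[h --> 0^'] --> l.
  by rewrite -fl; exact: df.
move/cvgrPdist_le => /(_ e e0) [d /= d0 H]; exists d => // s sd.
have [->|sx] := eqVneq s x; first by rewrite !subrr mulr0 subr0 normr0 mulr0.
have h0 : s - x != 0 by rewrite subr_eq0.
have := H (s - x); rewrite /ball_ /= sub0r normrN => /(_ sd h0).
rewrite /GRing.scale /= mulr1 subrK distrC => hh.
have -> : f s - f x - l * (s - x) = ((s - x)^-1 * (f s - f x) - l) * (s - x) by field.
by rewrite normrM ler_wpM2r.
Qed.

Lemma derivative_at_toC D f x l : is_derive x 1 f l ->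
  derivative_at D (fun s => toC (f s)) x (toC l).
Proof.
move=> df e /(is_derive_expansion df)[d d0 H]; exists d => // s _ /H.
by rewrite -!toCB -toCM -toCB modulus_toC.
Qed.

(** The set of times up to which the growth is at most [e] times the elapsed time
    is an interval containing 0; its supremum belongs to it, and the local bound at
    the supremum would extend it further unless it is [L]. *)
Lemma local_growth_global (phi : R -> R) (L : R) : 0 <= L ->
  (forall t e, 0 <= t <= L -> 0 < e -> exists2 d : R, 0 < d &
    forall s s', 0 <= s <= t -> t <= s' <= L -> t - d < s -> s' < t + d ->
      phi s' - phi s <= e * (s' - s)) ->
  forall t, 0 <= t <= L -> phi t <= phi 0.
Proof.
move=> L0 H t tL; apply/ler_addgt0Pr => e0 e00.
have c0 : 0 < L + 1 by rewrite ltr_wpDl.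
pose e := e0 / (L + 1); have e_gt0 : 0 < e by rewrite divr_gt0.
suff : forall s, 0 <= s <= L -> phi s - phi 0 <= e * s.
  move=> /(_ t tL) h; rewrite -lerBlDl (le_trans h) // /e mulrAC ler_pdivrMr //.
  by rewrite ler_pM2l //; lra.
pose S := [set u | 0 <= u <= L /\ forall s, 0 <= s <= u -> phi s - phi 0 <= e * s].
have S0 : S 0.
  split; first by rewrite lexx.
  move=> s /andP[s0 s0']; have -> : s = 0 by apply/eqP; rewrite eq_le s0 s0'.
  by rewrite subrr mulr0.
have hS : has_sup S by split; [exists 0 | exists L => u [/andP[]]].
pose c := sup S.
have c_ge0 : 0 <= c by apply: sup_upper_bound.
have cL : c <= L by apply: ge_sup; [exists 0 | move=> u [/andP[]]].
have c0L : 0 <= c <= L by rewrite c_ge0.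
have [d d0 Hd] := H c e c0L e_gt0.
have ok s : 0 <= s <= L -> s < c + d -> phi s - phi 0 <= e * s.
  move=> /andP[s0 sL] scd; have [sc|cs] := ltP s c.
    have cs0 : 0 < c - s by rewrite subr_gt0.
    have [u Su us] := sup_adherent cs0 hS.
    by case: Su => _; apply; rewrite s0 /=; move: us; rewrite -/c opprB addrC subrK => /ltW.
  have [u Su us] := sup_adherent d0 hS.
  have uc : u <= c by exact: sup_upper_bound.
  case: (Su) => /andP[u0 uL] /(_ u); rewrite u0 lexx => /(_ isT) h1.
  have := Hd u s; rewrite u0 uc cs sL us scd => /(_ isT isT isT isT) h2.
  lra.
move=> s sL; apply: (ok s) => //.
suff : L <= c by move: sL => /andP[_]; lra.
rewrite leNgt; apply/negP => cltL.
pose v := Num.min L (c + d / 2).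
have cv : c < v by rewrite lt_min cltL ltrDl divr_gt0.
have vL : v <= L by rewrite ge_min lexx.
have vcd : v <= c + d / 2 by rewrite ge_min lexx orbT.
suff Sv : S v by have := sup_upper_bound hS Sv; rewrite -/c leNgt cv.
split; first by rewrite vL (le_trans c_ge0) // ltW.
move=> u /andP[u0 uv]; apply: ok; first by rewrite u0 (le_trans uv).
by lra.
Qed.

End RealDerivatives.

Section MeanValue.
Variable R : realType.

Definition segment0 (L : R) : set R := [set t | 0 <= t <= L].

(** The weighted sum of moduli is only Lipschitz, not differentiable, so the mean
    value inequality is obtained from its growth near each point: there it grows no
    faster than the sum of the moduli of the derivatives. Working with a finite sum
    at once, rather than mode by mode, is what gives estimates in the l1 norm
    without integrating a series. *)
Lemma weighted_mean_value (I : choiceType) (F : {fset I}) (w : I -> R)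
    (y h : R -> I -> Cplx R) (beta beta' : R -> R) (L : R) : 0 <= L ->
  (forall i, 0 <= w i) ->
  (forall t i, segment0 L t -> derivative_at (segment0 L) (y^~ i) t (h t i)) ->
  (forall t, segment0 L t -> is_derive t 1 beta (beta' t)) ->
  (forall t, segment0 L t -> \sum_(i <- F) w i * modulus (h t i) <= beta' t) ->
  forall t, segment0 L t ->
    \sum_(i <- F) w i * modulus (y t i) <=
    \sum_(i <- F) w i * modulus (y 0 i) + (beta t - beta 0).
Proof.
move=> L0 w0 dy dbeta hb t tL.
pose N s := \sum_(i <- F) w i * modulus (y s i).
pose phi s := N s - beta s.
suff : phi t <= phi 0 by rewrite /phi /N; lra.
apply: (local_growth_global L0) tL => {}t e tL e0.
have W0 : 0 <= \sum_(i <- F) w i by exact: sumr_ge0.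
have c0 : 0 < \sum_(i <- F) w i + 1 by rewrite ltr_wpDl.
pose e1 := e / 2 / (\sum_(i <- F) w i + 1).
have e10 : 0 < e1 by rewrite !divr_gt0.
have [d1 d10 H1] : exists2 d : R, 0 < d & forall i s, i \in enum_fset F ->
    segment0 L s -> `|s - t| < d ->
    modulus (y s i - y t i) <= (modulus (h t i) + e1) * `|s - t|.
  elim: (enum_fset F) => [|i r [d d0 IH]]; first by exists 1.
  have [d' d'0 H'] := dy t i tL e1 e10.
  exists (Num.min d d'); first by rewrite lt_min d0.
  move=> j s; rewrite inE lt_min => jr sL /andP[sd sd'].
  case/predU1P: jr => [->|jr]; last exact: IH.
  have -> : y s i - y t i = (y s i - y t i - h t i * toC (s - t)) + h t i * toC (s - t).
    by ring.
  rewrite (le_trans (modulusD _ _)) // modulusM modulus_toC mulrDl addrC lerD2l.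
  exact: H'.
have e20 : 0 < e / 2 by rewrite divr_gt0.
have [d2 d20 H2] := is_derive_expansion (dbeta t tL) e20.
exists (Num.min d1 d2); first by rewrite lt_min d10.
have HN s : segment0 L s -> `|s - t| < d1 -> `|N s - N t| <= (beta' t + e / 2) * `|s - t|.
  move=> sL sd; rewrite /N -sumrB (le_trans (ler_norm_sum _ _ _)) //.
  apply: (@le_trans _ _ (\sum_(i <- F) w i * ((modulus (h t i) + e1) * `|s - t|))).
    rewrite big_seq [leRHS]big_seq; apply: ler_sum => i iF.
    rewrite -mulrBr normrM ger0_norm // ler_wpM2l //.
    by rewrite (le_trans (modulus_dist _ _)) // H1.
  under eq_bigr do rewrite mulrA mulrDr.
  rewrite -mulr_suml big_split /= ler_wpM2r // lerD ?hb // -mulr_suml /e1.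
  by rewrite mulrCA ler_piMr ?(ltW e20) // ler_pdivrMr // mul1r lerDl.
move=> s s' /andP[s0 st] /andP[ts' s'L] tds s'td.
have /andP[t0 tL'] := tL.
have sL : segment0 L s by rewrite /segment0 /= s0 (le_trans st).
have s'L' : segment0 L s' by rewrite /segment0 /= s'L (le_trans t0).
have a1 : `|s - t| = t - s by rewrite ler0_norm ?opprB // subr_le0.
have a2 : `|s' - t| = s' - t by rewrite ger0_norm // subr_ge0.
have b1 : `|s - t| < Num.min d1 d2 by rewrite a1; lra.
have b2 : `|s' - t| < Num.min d1 d2 by rewrite a2; lra.
move: b1 b2; rewrite !lt_min => /andP[b1 b1'] /andP[b2 b2'].
have := HN s sL b1; have := HN s' s'L' b2; have := H2 s b1'; have := H2 s' b2'.
rewrite a1 a2 !ler_norml => /andP[q1 q1'] /andP[q2 q2'] /andP[q3 q3'] /andP[q4 q4'].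
rewrite /phi; lra.
Qed.

End MeanValue.

Lemma is_derive_linear (R : realType) (k t : R) :
  is_derive t (1 : R) (fun x : R => k * x) k.
Proof.
have h := is_deriveZ k (is_derive_id t (1 : R)).
by apply: (is_derive_eq h); rewrite /GRing.scale /= mulr1.
Qed.

(** * Termwise differentiation, exponentials and antiderivatives *)

Section Termwise.
Variable R : realType.

Definition convex_set (D : set R) := forall s t x, D s -> D t -> 0 <= x <= 1 ->
  D (t + x * (s - t)).

Lemma convex_segment0 L : convex_set (segment0 L).
Proof.
move=> s t x /andP[s0 sL] /andP[t0 tL] /andP[x0 x1]; rewrite /segment0 /=.
have -> : t + x * (s - t) = x * s + (1 - x) * t by ring.
have x1' : 0 <= 1 - x by rewrite subr_ge0.
apply/andP; split; first by rewrite addr_ge0 // mulr_ge0.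
have -> : L = x * L + (1 - x) * L by ring.
by rewrite lerD // ler_wpM2l.
Qed.

Lemma sum_modulus_lipschitz (I : choiceType) (F : {fset I}) (D : set R)
    (f g : R -> I -> Cplx R) (C : R) s t : convex_set D ->
  (forall u i, D u -> derivative_at D (f^~ i) u (g u i)) ->
  (forall u, D u -> \sum_(i <- F) modulus (g u i) <= C) ->
  D s -> D t -> \sum_(i <- F) modulus (f s i - f t i) <= C * `|s - t|.
Proof.
move=> Dconv df gC Ds Dt.
pose y (x : R) i : Cplx R := f (t + x * (s - t)) i - f t i.
pose h (x : R) i : Cplx R := g (t + x * (s - t)) i * toC (s - t).
have is01 : segment0 1 (1 : R) by rewrite /segment0 /= ler01 lexx.
have := @weighted_mean_value R I F (fun=> 1) y h (fun x => C * `|s - t| * x)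
  (fun=> C * `|s - t|) 1 ler01 (fun=> ler01) _ _ _ 1 is01.
rewrite /y mul1r (addrC t) subrK mul0r addr0 mulr0 subr0 mulr1.
rewrite [X in _ <= X + _]big1 ?add0r; last first.
  by move=> i _; rewrite subrr modulus0 mulr0.
under eq_bigr do rewrite mul1r; apply.
- move=> x i x01.
  have := @derivative_atB _ (segment0 1) (fun x => f (t + x * (s - t)) i)
    (fun=> f t i) x (h x i) 0 _ (derivative_at_cst _ _ _).
  rewrite subr0; apply; apply: (@derivative_at_affine _ D _ (f^~ i)) => [v v01|]; first exact: Dconv.
  by apply: df; exact: Dconv.
- move=> x _; exact: is_derive_linear.
move=> x x01; under eq_bigr do rewrite mul1r /h modulusM modulus_toC.
by rewrite -mulr_suml ler_wpM2r // gC //; exact: Dconv.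
Qed.

(** Split the first-order error of the sum at a finite set off which the sums of
    the derivatives are uniformly small; off that set, increments are controlled by
    the mean value inequality. *)
Lemma derivative_at_sums_to (I : choiceType) (D : set R)
    (f g : R -> I -> Cplx R) (S : R -> Cplx R) (t : R) (l : Cplx R) :
  convex_set D ->
  (forall u i, D u -> derivative_at D (f^~ i) u (g u i)) ->
  small_tails D (fun u i => modulus (g u i)) ->
  (forall u, D u -> sums_to (f u) (S u)) -> D t -> sums_to (g t) l ->
  derivative_at D S t l.
Proof.
move=> Dconv df gtail fS Dt gl e e0.
have e30 : 0 < e / 3 by rewrite divr_gt0.
have [F0 HF0] := gtail _ e30.
pose q s i := f s i - f t i - g t i * toC (s - t).
have [d d0 Hd] : exists2 d : R, 0 < d & forall s, D s -> `|s - t| < d ->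
    modulus (\sum_(i <- F0) q s i) <= e / 3 * `|s - t|.
  have := derivative_at_sum F0 (fun i => df t i Dt) e30; case=> d d0 H.
  exists d => // s Ds /(H s Ds); rewrite -sumrB mulr_suml -sumrB.
  by congr (modulus _ <= _).
exists d => // s Ds /(Hd s Ds) hq.
have qQ : sums_to (q s) (S s - S t - l * toC (s - t)).
  apply: sums_toB; first exact: sums_toB (fS _ Ds) (fS _ Dt).
  by rewrite mulrC; have := sums_toZ (toC (s - t)) gl; apply: sums_to_ext => i; rewrite mulrC.
have := sums_to_remainder qQ (e := 2 * (e / 3) * `|s - t|) _ (fsubset_refl F0).
set A := \sum_(i <- F0) _ in hq *; set B := S s - S t - _ => H.
have -> : B = A - (A - B) by ring.
rewrite (le_trans (modulusD _ _)) // modulusN.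
have -> : e * `|s - t| = e / 3 * `|s - t| + 2 * (e / 3) * `|s - t| by field.
apply: lerD => //; apply: H => G FG.
have h1 : \sum_(i <- G) modulus (f s i - f t i) <= e / 3 * `|s - t|.
  by apply: (sum_modulus_lipschitz Dconv df) => // u Du; exact: HF0.
have h2 : \sum_(i <- G) modulus (g t i) * `|s - t| <= e / 3 * `|s - t|.
  by rewrite -mulr_suml ler_wpM2r // HF0.
have -> : 2 * (e / 3) * `|s - t| = e / 3 * `|s - t| + e / 3 * `|s - t| by ring.
apply: le_trans (lerD h1 h2); rewrite -big_split; apply: ler_sum => i _ /=.
by rewrite (le_trans (modulusD _ _)) // modulusN modulusM modulus_toC.
Qed.

Lemma continuous_on_at_sums_to (I : choiceType) (D : set R)
    (f : R -> I -> Cplx R) (S : R -> Cplx R) t :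
  (forall i, continuous_on_at D (f^~ i) t) ->
  small_tails D (fun u i => modulus (f u i)) ->
  (forall u, D u -> sums_to (f u) (S u)) -> D t ->
  continuous_on_at D S t.
Proof.
move=> cf tails fS Dt e e0.
have e30 : 0 < e / 3 by rewrite divr_gt0.
have [F0 HF0] := tails _ e30.
have rem u : D u -> modulus (\sum_(i <- F0) f u i - S u) <= e / 3.
  move=> Du; apply: (sums_to_remainder (fS u Du)) (fsubset_refl F0) => G FG.
  exact: HF0.
have [d d0 Hd] : exists2 d : R, 0 < d & forall s, D s -> `|s - t| < d ->
    modulus (\sum_(i <- F0) f s i - \sum_(i <- F0) f t i) <= e / 3.
  have : forall e, 0 < e -> exists2 d : R, 0 < d & forall s, D s -> `|s - t| < d ->
    modulus (\sum_(i <- F0) f s i - \sum_(i <- F0) f t i) <= e.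
    elim: (enum_fset F0) => [|i r IH] e1 e10.
      by exists 1 => // s _ _; rewrite !big_nil subrr modulus0 ltW.
    have e120 : 0 < e1 / 2 by rewrite divr_gt0.
    have [d d0 H] := IH _ e120; have [d' d'0 H'] := cf i _ e120.
    exists (Num.min d d'); first by rewrite lt_min d0.
    move=> s Ds; rewrite lt_min => /andP[/(H s Ds) h /(H' s Ds) h'].
    by rewrite !big_cons opprD addrACA (le_trans (modulusD _ _)) // (splitr e1) lerD.
  by apply.
exists d => // s Ds /(Hd s Ds); have := rem s Ds; have := rem t Dt.
set A := \sum_(i <- F0) _; set B := \sum_(i <- F0) _ => h1 h2 h3.
have -> : S s - S t = (B - A) - (B - S s) + (A - S t) by ring.
rewrite (le_trans (modulusD _ _)) // (le_trans (lerD (modulusD _ _) (lexx _))) //.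
by rewrite modulusN; lra.
Qed.

(** Weierstrass M-test. *)
Lemma small_tails_dominated (T : Type) (D : set T) (I : choiceType)
    (g : T -> I -> R) (b : I -> R) M :
  (forall i, 0 <= b i) -> (forall t i, D t -> g t i <= b i) ->
  finite_sums_le b M -> small_tails D g.
Proof.
move=> b0 gb bM e e0; have [F0 H] := finite_sums_le_tail b0 bM e0.
exists F0 => t G Dt FG; apply: le_trans (H G FG); apply: ler_sum => i _; exact: gb.
Qed.

End Termwise.

Section Exponential.
Variable R : realType.
Implicit Types (x y k : R).

Lemma expiD x y : expi (x + y) = expi x * expi y.
Proof.
apply/eqP; rewrite eq_complex; apply/andP; split; apply/eqP.
  exact: cosD.
by rewrite /= sinD addrC mulrC [sin x * _]mulrC.
Qed.

Lemma expi0 : expi 0 = 1 :> Cplx R.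
Proof. by rewrite /expi cos0 sin0. Qed.

Lemma modulus_expi x : modulus (expi x) = 1.
Proof. by rewrite /modulus /= cos2Dsin2 sqrtr1. Qed.

Lemma expi_pi : expi pi = -1 :> Cplx R.
Proof. by apply/eqP; rewrite eq_complex /= cospi sinpi oppr0 !eqxx. Qed.

(** Multiplication by i of a real; [ifreq] is [toI] of the frequency. *)
Definition toI (k : R) : Cplx R := (0 +i* k)%C.

Lemma modulus_toI k : modulus (toI k) = `|k|.
Proof. by rewrite /modulus /= expr0n /= add0r sqrtr_sqr. Qed.

Lemma derivative_at_expi D k x :
  derivative_at D (fun x => expi (k * x)) x (toI k * expi (k * x)).
Proof.
have dk := is_derive_linear k x.
have dc : is_derive x 1 (fun x : R => cos (k * x)) (- sin (k * x) * k).
  exact: (is_derive1_comp _ dk).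
have ds : is_derive x 1 (fun x : R => sin (k * x)) (cos (k * x) * k).
  exact: (is_derive1_comp _ dk).
have := derivative_atD (derivative_at_toC D dc)
  (derivative_atZ ('i)%C (derivative_at_toC D ds)).
have -> : (fun s => toC (cos (k * s)) + ('i)%C * toC (sin (k * s))) =
  (fun x => expi (k * x)).
  apply/funext => s; apply/eqP; rewrite eq_complex; apply/andP.
  by split; apply/eqP => /=; ring.
congr derivative_at; apply/eqP; rewrite eq_complex; apply/andP.
by split; apply/eqP => /=; ring.
Qed.

Lemma toIN (k : R) : toI (- k) = - toI k.
Proof. by apply/eqP; rewrite eq_complex /= oppr0 !eqxx. Qed.

Lemma expiNK (x : R) : expi (- x) * expi x = 1 :> Cplx R.
Proof. by rewrite -expiD addNr expi0. Qed.

End Exponential.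

Section Antiderivative.
Variable R : realType.

Lemma real_antiderivative (f : R -> R) (L : R) : 0 <= L -> continuous f ->
  exists F : R -> R, F 0 = 0 /\ forall t, 0 <= t <= L -> is_derive t 1 F (f t).
Proof.
move=> L0 cf.
pose mu := @lebesgue_measure R.
pose G x := (\int[mu]_(t in [set` `[(-1)%R, x]]) (f t))%R.
exists (fun x => G x - G 0); rewrite subrr; split=> // t /andP[t0 tL].
have [dG Gf] : derivable G t 1 /\ derive1 G t = f t.
  apply: (@continuous_FTC1_closed _ f (-1) t (L + 1)) => //.
  - by lra.
  - apply: continuous_compact_integrable; first exact: segment_compact.
    by apply: continuous_subspaceT => ?; exact: cf.
  - by lra.
  - exact: cf.
have dG' : is_derive t 1 G (f t) by split=> //; rewrite -derive1E.
have h := is_deriveB dG' (is_derive_cst (G 0) t 1).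
by apply: (is_derive_eq h); rewrite subr0.
Qed.

Lemma antiderivative (f : R -> Cplx R) (L : R) : 0 <= L ->
  (forall t, continuous_on_at setT f t) ->
  exists F : R -> Cplx R, F 0 = 0 /\
    forall t, segment0 L t -> derivative_at (segment0 L) F t (f t).
Proof.
move=> L0 cf.
have part (g : Cplx R -> R) : (forall z w, g (z - w) = g z - g w) ->
    (forall z, `|g z| <= modulus z) -> continuous (g \o f).
  move=> gB gm t; apply/cvgrPdist_le => e e0; have [d d0 H] := cf t e e0.
  apply: filterS (nbhsx_ballx t d d0) => s; rewrite /ball /= => st.
  by rewrite distrC -gB (le_trans (gm _)) // H // distrC.
have [A [A0 dA]] := real_antiderivative L0 (part _ (@reB R) (@re_le R)).
have [B [B0 dB]] := real_antiderivative L0 (part _ (@imB R) (@im_le R)).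
exists (fun t => toC (A t) + ('i)%C * toC (B t)); split.
  by rewrite A0 B0 toC0 mulr0 addr0.
move=> t tL; rewrite [f t]complexE.
have := derivative_atD (derivative_at_toC (segment0 L) (dA t tL))
  (derivative_atZ ('i)%C (derivative_at_toC (segment0 L) (dB t tL))).
by [].
Qed.

End Antiderivative.

(** * Translation between filters and epsilons *)

Section LibraryBridges.
Variable R : realType.
Implicit Types (D : set R) (f : R -> Cplx R) (L : R).

Lemma has_derivative_inP D f t l :
  has_derivative_in D f t l <-> derivative_at D f t l.
Proof.
split=> [/cvgrPdist_le H e e0|H].
  have := H (toC e); rewrite -toC0 toC_lt => /(_ e0)[d /= d0 Hd].
  exists d => // s Ds sd; have [->|st] := eqVneq s t.
    by rewrite !subrr toC0 mulr0 subr0 modulus0 normr0 mulr0.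
  have st0 : toC (s - t) != 0 by rewrite -toC0 (inj_eq (@toC_inj R)) subr_eq0.
  have := Hd s; rewrite /ball_ /= distrC => /(_ sd st Ds).
  rewrite modulusE toC_le => h; rewrite modulusB in h.
  have -> : f s - f t - l * toC (s - t) = ((f s - f t) / toC (s - t) - l) * toC (s - t).
    by rewrite mulrBl divfK.
  by rewrite modulusM modulus_toC ler_wpM2r.
apply/cvgrPdist_le => z /toC_gt0[e e0 ->]; have [d d0 Hd] := H e e0.
exists d => //= s; rewrite /ball_ /= distrC => sd st Ds.
have st0 : toC (s - t) != 0 by rewrite -toC0 (inj_eq (@toC_inj R)) subr_eq0.
have st0' : 0 < `|s - t| by rewrite normr_gt0 subr_eq0.
rewrite modulusE toC_le modulusB -(ler_pM2r st0') -{1}modulus_toC -modulusM.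
have -> : ((f s - f t) / toC (s - t) - l) * toC (s - t) = f s - f t - l * toC (s - t).
  by rewrite mulrBl divfK.
exact: Hd.
Qed.

Lemma segment0E L : `[0, L]%classic = segment0 L.
Proof. exact: set_itvcc. Qed.

Lemma continuous_within_segment0 L f :
  (forall t, segment0 L t -> continuous_on_at (segment0 L) f t) ->
  {within `[0, L], continuous f}.
Proof.
move=> cf; rewrite segment0E; apply/subspace_continuousP => t tL.
apply/cvgrPdist_le => z /toC_gt0[e e0 ->]; have [d d0 H] := cf t tL e e0.
apply: filterS (nbhsx_ballx t d d0) => s; rewrite /ball /= => st sL.
by rewrite modulusE toC_le modulusB H // distrC.
Qed.

Lemma uniform_cvg_partial_sums (T : choiceType) (I : choiceType) (A : set T)
    (c : T -> I -> Cplx R) (f : T -> Cplx R) :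
  {uniform A, (fun (F : {fset I}) (z : T) => partial_sum (c z) F) @ totally --> f}
  <-> forall e : R, 0 < e -> exists F0 : {fset I}, forall (F : {fset I}) z,
    (F0 `<=` F)%fset -> A z -> modulus (\sum_(i <- F) c z i - f z) <= e.
Proof.
have psE z F : partial_sum (c z) F = \sum_(i <- F) c z i.
  by rewrite /partial_sum big_seq_fsetE.
split=> [H e e0|H].
  have /H[F0 _ HF0] : nbhs (f : {uniform` A -> Cplx R})
     [set g | forall z, A z -> ball (f z) (toC e) (g z)].
    apply/uniform_nbhs; exists [set xy | ball xy.1 (toC e) xy.2]; split => //.
    by rewrite -entourage_ballE; exists (toC e); rewrite //= -toC0 toC_lt.
  exists F0 => F z /HF0 /= h Az; have := h z Az.
  by rewrite /ball /= psE modulusE toC_lt => /ltW h'; rewrite modulusB.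
move=> P /uniform_nbhs[E [+ EP]]; rewrite -entourage_ballE => -[z0 /= z00 HE].
have [e e0 ez] := toC_gt0 z00.
have [F0 HF] := H _ (divr_gt0 e0 (ltr0n R 2)).
exists F0 => // F /HF {}HF; apply: EP => z Az /=; apply: HE => /=.
rewrite /ball /= psE modulusE ez toC_lt modulusB (le_lt_trans (HF z Az)) //.
by rewrite ltr_pdivrMr // ltr_pMr // ltr1n.
Qed.

Lemma summable_finite_sums (I : choiceType) (g : I -> R) M : (forall i, 0 <= g i) ->
  finite_sums_le g M -> esum.summable [set: I] (fun i => (g i)%:E).
Proof.
move=> g0 gM; rewrite /esum.summable (@le_lt_trans _ _ M%:E) ?ltry //.
apply: ge_ereal_sup => _ [A [finA _] <-].
rewrite fsbig_finite //=; under eq_bigr do rewrite ger0_norm //.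
by rewrite sumEFin lee_fin.
Qed.

End LibraryBridges.

Section TailsOfUniformConvergence.
Variable R : realType.

(** Apply the hypothesis to the four subsets on which the real, respectively the
    imaginary, part has a constant sign. *)
Lemma sum_modulus_le_subsets (I : choiceType) (a : I -> Cplx R) (G : {fset I}) e :
  (forall G', (G' `<=` G)%fset -> modulus (\sum_(i <- G') a i) <= e) ->
  \sum_(i <- G) modulus (a i) <= 4 * e.
Proof.
move=> aG.
have part (g : {additive Cplx R -> R}) : (forall z, `|g z| <= modulus z) ->
    \sum_(i <- G) `|g (a i)| <= 2 * e.
  move=> gm; pose P := [pred i | 0 <= g (a i)].
  rewrite (big_fsetID _ P) /= mulr_natl mulr2n; apply: lerD.
    have s1 : ([fset x in G | P x] `<=` G)%fset.
      by apply/fsubsetP => i; rewrite !inE => /andP[].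
    apply: le_trans (aG _ s1); apply: le_trans (gm _).
    rewrite raddf_sum (le_trans _ (ler_norm _)) //= big_seq [leRHS]big_seq.
    by apply: ler_sum => i; rewrite !inE /= => /andP[_ /ger0_norm ->].
  have s2 : ([fset x in G | ~~ P x] `<=` G)%fset.
    by apply/fsubsetP => i; rewrite !inE => /andP[].
  apply: le_trans (aG _ s2); apply: le_trans (gm _).
  rewrite raddf_sum -normrN (le_trans _ (ler_norm _)) //= -sumrN big_seq [leRHS]big_seq.
  by apply: ler_sum => i; rewrite !inE /= -ltNge => /andP[_ /ltr0_norm ->].
have h1 := part (@complex.Re R : {additive R[i] -> R}) (@re_le R).
have h2 := part (@complex.Im R : {additive R[i] -> R}) (@im_le R).
have := lerD h1 h2; rewrite -big_split /= => h.
apply: (le_trans _ (le_trans h _)); last by lra.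
by apply: ler_sum => i _; exact: modulus_le.
Qed.

(** Uniform convergence along finite sets is uniform for all subsets of a tail,
    hence upgrades to uniform absolute convergence. *)
Lemma small_tails_uniform (T : Type) (I : choiceType) (A : set T)
    (c : T -> I -> Cplx R) (f : T -> Cplx R) :
  (forall e : R, 0 < e -> exists F0 : {fset I}, forall (F : {fset I}) z,
    (F0 `<=` F)%fset -> A z -> modulus (\sum_(i <- F) c z i - f z) <= e) ->
  small_tails A (fun z i => modulus (c z i)).
Proof.
(* 8 = 4 * 2: four sign classes, and a tail is a difference of two partial sums. *)
move=> H e e0; have e80 : 0 < e / 8 by rewrite divr_gt0.
have [F0 HF] := H _ e80; exists F0 => z G Az FG.
have -> : e = 4 * (2 * (e / 8)) by field.
apply: sum_modulus_le_subsets => G' G'G.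
have FG' : [disjoint F0 & G']%fset.
  apply/fdisjointP => i iF; apply/negP => /(fsubsetP G'G).
  by apply/negP; exact: (fdisjointP FG).
have := HF _ z (fsubsetUl F0 G') Az; have := HF _ z (fsubset_refl F0) Az.
rewrite sum_fsetU //; set S := \sum_(i <- F0) _; set S' := \sum_(i <- G') _ => h1 h2.
have -> : S' = (S + S' - f z) - (S - f z) by ring.
rewrite (le_trans (modulusD _ _)) // modulusN; lra.
Qed.

Lemma small_tails_bounded (T : Type) (D : set T) (I : choiceType)
    (g : T -> I -> R) t : (forall i, 0 <= g t i) ->
  small_tails D g -> D t -> exists M, finite_sums_le (g t) M.
Proof.
move=> g0 tails Dt; have [F0 HF] := tails 1 ltr01.
exists (\sum_(i <- F0) g t i + 1) => F.
apply: (le_trans (sum_fset_le g0 (fsubsetUr F0 F))).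
rewrite (sum_fset_split _ (fsubsetUl F0 F)) lerD2l HF //.
by apply/fdisjointP => i iF; rewrite !inE iF.
Qed.

End TailsOfUniformConvergence.

(** * Uniqueness of quasi-periodic Fourier coefficients *)

Section Modes.
Variables (R : realType) (nu : nat) (omega : 'rV[R]_nu).
Local Notation Z := 'rV[int]_nu.

Lemma freqD m n : freq omega (m + n) = freq omega m + freq omega n.
Proof.
by rewrite /freq -big_split; apply: eq_bigr => j _; rewrite mxE intrD mulrDl.
Qed.

Lemma freqN n : freq omega (- n) = - freq omega n.
Proof.
by rewrite /freq -sumrN; apply: eq_bigr => j _; rewrite mxE mulrNz mulNr.
Qed.

Lemma freq_inj : rationally_independent omega -> injective (freq omega).
Proof.
move=> ind m n mn; apply/eqP; rewrite -subr_eq0; apply/eqP/ind.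
by rewrite freqD freqN mn subrr.
Qed.

Lemma modulus_mode n x : modulus (mode omega n x) = 1.
Proof. exact: modulus_expi. Qed.

Lemma mode0 n : mode omega n 0 = 1.
Proof. by rewrite /mode mulr0 expi0. Qed.

Lemma mode_character x : unitary_character (fun n => mode omega n x).
Proof.
split=> [n|m n]; first exact: modulus_mode.
by rewrite /mode freqD mulrDl expiD.
Qed.

Lemma modeD n x y : mode omega n (x + y) = mode omega n x * mode omega n y.
Proof. by rewrite /mode mulrDr expiD. Qed.

Lemma derivative_at_mode D n x :
  derivative_at D (mode omega n) x (ifreq omega n * mode omega n x).
Proof. exact: derivative_at_expi. Qed.

Lemma modulus_ifreq n : modulus (ifreq omega n) = `|freq omega n|.
Proof. exact: modulus_toI. Qed.

(** Replacing [f] by [x |-> (f x + exp (- i theta_k h) f (x + h)) / 2], where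
    [theta_n] is the frequency of mode [n], multiplies the coefficient [c n] by
    [(1 + exp (i (theta_n - theta_k) h)) / 2]. This keeps [c k], does not increase
    any modulus, and removes a chosen mode [n0] when [h = pi / (theta_n0 - theta_k)].
    After the modes of [s] have been removed, only [c k] and a small tail remain.
    Rational independence is what makes the denominator nonzero. *)
Lemma fourier_coefficient_le (k : Z) (e : R) (s : seq Z) :
  rationally_independent omega -> k \notin s ->
  forall c : Z -> Cplx R,
  (forall x, sums_to (fun n => c n * mode omega n x) 0) ->
  (forall G : {fset Z}, (forall n, n \in G -> n \notin k :: s) ->
     \sum_(n <- G) modulus (c n) <= e) ->
  modulus (c k) <= e.
Proof.
move=> ind; elim: s => [|n0 s IH] ks c c0 tail.
  have c00 : sums_to c 0.
    by apply: sums_to_ext (c0 0) => n; rewrite mode0 mulr1.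
  have := @sums_to_remainder _ _ c 0 [fset k]%fset e c00 _ _ (fsubset_refl _).
  rewrite big_seq_fset1 subr0; apply => G kG; apply: tail => n nG.
  rewrite inE; apply/eqP => nk; move: (fdisjointP kG k).
  by rewrite inE eqxx -nk nG => /(_ isT).
move: ks; rewrite inE negb_or => /andP[kn0 ks].
pose h := pi / (freq omega n0 - freq omega k).
have dn0 : freq omega n0 - freq omega k != 0.
  by rewrite subr_eq0 (inj_eq (freq_inj ind)) eq_sym.
pose c' n := 2^-1 * (1 + expi ((freq omega n - freq omega k) * h)) * c n.
have half : modulus (2^-1 : Cplx R) = 2^-1.
  by rewrite modulusV -(toC_nat _ 2) modulus_toC ger0_norm.
have c'k : c' k = c k.
  by rewrite /c' subrr mul0r expi0 -[1 + 1]/(2%:R) mulVf ?mul1r // pnatr_eq0.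
have c'n0 : c' n0 = 0.
  by rewrite /c' /h mulrCA divff // mulr1 expi_pi subrr mulr0 mul0r.
have c'c n : modulus (c' n) <= modulus (c n).
  rewrite /c' !modulusM ler_piMl ?modulus_ge0 // half mulrC ler_pdivrMr // mul1r.
  rewrite (le_trans (modulusD _ _)) // modulus_expi.
  by rewrite -toC1 modulus_toC normr1.
rewrite -c'k; apply: IH => // [x|G Gks].
  have := sums_toD (c0 x) (sums_toZ (expi (- (freq omega k * h))) (c0 (x + h))).
  rewrite mulr0 addr0 => /(sums_toZ 2^-1); rewrite mulr0.
  apply: sums_to_ext => n; rewrite modeD /c' mulrBl expiD -/(mode omega n h).
  ring.
rewrite (big_fsetID _ (pred1 n0)) /= big_seq big1 ?add0r; last first.
  by move=> n; rewrite !inE => /andP[_ /eqP ->]; rewrite c'n0 modulus0.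
apply: (@le_trans _ _ (\sum_(n <- [fset x | x in G & x != n0]%fset) modulus (c n))).
  by apply: ler_sum => n _.
apply: tail => n; rewrite !inE /= => /andP[/Gks]; rewrite inE negb_or => /andP[nk ns] nn0.
by rewrite negb_or nk negb_or nn0.
Qed.

(** Remove all modes other than [k] of a finite set with small tail. *)
Lemma fourier_coefficients_unique (c : Z -> Cplx R) M :
  rationally_independent omega -> finite_sums_le (modulus \o c) M ->
  (forall x, sums_to (fun n => c n * mode omega n x) 0) -> forall k, c k = 0.
Proof.
move=> ind cM c0 k; apply/modulus_eq0/eqP; rewrite eq_le modulus_ge0 andbT.
apply/ler_addgt0Pr => e e0; rewrite add0r.
have [F0 HF] := finite_sums_le_tail (fun n => modulus_ge0 (c n)) cM e0.
have kF : k \notin [seq n <- enum_fset F0 | n != k].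
  by rewrite mem_filter eqxx.
apply: (fourier_coefficient_le ind kF c0) => G HG; apply: HF.
apply/fdisjointP => n nF; apply/negP => /HG.
by rewrite inE negb_or mem_filter => /andP[-> /=]; rewrite nF.
Qed.

End Modes.

(** * Exponential weights *)

Section Decay.
Variable R : realType.

Lemma finite_sums_le_geometric (q : R) : 0 <= q < 1 ->
  finite_sums_le (fun n : nat => q ^+ n) (1 - q)^-1.
Proof.
move=> /andP[q0 q1] F; have q1' : 0 < 1 - q by rewrite subr_gt0.
pose N := (\max_(n <- F) n.+1)%N.
pose G : {fset nat} := [fset n in iota 0 N]%fset.
have FG : (F `<=` G)%fset.
  apply/fsubsetP => n nF; rewrite !inE mem_iota /= add0n /N.
  exact: (@leq_bigmax_seq _ (enum_fset F) xpredT S n nF isT).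
apply: le_trans (sum_fset_le (fun n => exprn_ge0 n q0) FG) _.
rewrite big_imfset //= undup_id ?iota_uniq // -[N in iota 0 N]subn0 -/(index_iota 0 N).
rewrite -(ler_pM2l q1') divff ?gt_eqF //.
have -> : (1 - q) * (\sum_(0 <= i < N) q ^+ i) = 1 - q ^+ N.
  elim: N {G FG} => [|N IH]; first by rewrite big_nil mulr0 subrr.
  by rewrite big_nat_recr //= mulrDr IH exprS; ring.
by rewrite gerBl exprn_ge0.
Qed.

Lemma finite_sums_le_int (q : R) : 0 <= q < 1 ->
  finite_sums_le (fun z : int => q ^+ `|z|%N) ((1 + q) / (1 - q)).
Proof.
move=> q01 F; have /andP[q0 q1] := q01; rewrite mulrDl mul1r.
rewrite (big_fsetID _ (fun z : int => 0 <= z)) /=; apply: lerD.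
  set G := [fset x in F | 0 <= x]%fset.
  have := finite_sums_le_geometric q01 (absz @` G)%fset; rewrite big_imfset //=.
  move=> x y; rewrite !inE /= => /andP[_ x0] /andP[_ y0] xy.
  by rewrite -(gez0_abs x0) -(gez0_abs y0) xy.
set G := [fset x in F | ~~ (0 <= x)]%fset.
have := ler_wpM2l q0 (finite_sums_le_geometric q01 ((fun z => `|z|%N.-1) @` G)%fset).
have neg z : z \in G -> z = - (`|z|%N.-1.+1 : int).
  by rewrite !inE /= -ltNge => /andP[_]; case: z.
rewrite big_imfset /=; last by move=> x y /neg -> /neg ->; rewrite !abszN /= => ->.
apply: le_trans; rewrite mulr_sumr big_seq [leRHS]big_seq; apply: ler_sum => z zG.
by rewrite -exprS {1}(neg z zG) abszN.
Qed.

(** Finitely many row vectors lie in a finite box, over which the sum of products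
    is the product of sums. *)
Lemma finite_sums_le_row (J : choiceType) (g : J -> R) Q m : (forall j, 0 <= g j) ->
  finite_sums_le g Q ->
  finite_sums_le (fun n : 'rV[J]_m => \prod_(j < m) g (n ord0 j)) (Q ^+ m).
Proof.
move=> g0 gQ F.
pose E : {fset J} := (\bigcup_(n <- F) [fset n ord0 j | j in 'I_m])%fset.
pose row_of (f : {ffun 'I_m -> E}) : 'rV[J]_m := \row_j val (f j).
have row_inj : injective row_of.
  by move=> f h /rowP fh; apply/ffunP => j; apply/val_inj; have := fh j; rewrite !mxE.
pose G : {fset 'rV[J]_m} := [fset row_of f | f in {: {ffun 'I_m -> E}}]%fset.
have FG : (F `<=` G)%fset.
  apply/fsubsetP => n nF; apply/imfsetP => /=.
  have nE j : n ord0 j \in E.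
    by apply/bigfcupP; exists n; rewrite ?nF //; apply/imfsetP; exists j.
  exists [ffun j => [` nE j]%fset] => //; apply/rowP => j.
  by rewrite mxE ffunE.
have P0 (n : 'rV[J]_m) : 0 <= \prod_(j < m) g (n ord0 j) by exact: prodr_ge0.
apply: le_trans (sum_fset_le P0 FG) _.
rewrite big_imfset /=; last by move=> f h _ _; exact: row_inj.
have -> : Q ^+ m = \prod_(j < m) Q by rewrite prodr_const card_ord.
apply: (@le_trans _ _ (\prod_(j < m) \sum_(x : E) g (val x))); last first.
  apply: ler_prod => j _; rewrite sumr_ge0 //=.
  by have := gQ E; rewrite big_seq_fsetE.
rewrite bigA_distr_bigA /= big_enum /=.
by apply: ler_sum => f _; under eq_bigr do rewrite mxE.
Qed.

Variable nu : nat.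
Local Notation Z := 'rV[int]_nu.

Definition exp_weight (s : R) (n : Z) : R := expR (s * (norm1 n)%:R).

Lemma exp_weight_gt0 s n : 0 < exp_weight s n.
Proof. exact: expR_gt0. Qed.

Lemma exp_weightD s s' n : exp_weight s n * exp_weight s' n = exp_weight (s + s') n.
Proof. by rewrite /exp_weight -expRD mulrDl. Qed.

Lemma exp_weightN s n : exp_weight (- s) n = (exp_weight s n)^-1.
Proof. by rewrite /exp_weight mulNr expRN. Qed.

Lemma exp_weight_le s s' n : s <= s' -> exp_weight s n <= exp_weight s' n.
Proof. by move=> ss; rewrite ler_expR ler_wpM2r. Qed.

Lemma norm1D (m n : Z) : (norm1 (m + n) <= norm1 m + norm1 n)%N.
Proof.
rewrite /norm1 -big_split /=; apply: leq_sum => j _; rewrite mxE.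
by rewrite -lez_nat PoszD !abszE ler_normD.
Qed.

Lemma exp_weight_submultiplicative s : 0 <= s -> submultiplicative_weight (exp_weight s).
Proof.
move=> s0; split=> [n|m n]; first by rewrite /exp_weight -expR0 ler_expR mulr_ge0.
by rewrite /exp_weight -expRD -mulrDr ler_expR ler_wpM2l // -natrD ler_nat norm1D.
Qed.

(** In dimension one the sum is [(1 + q) / (1 - q)] with [q = exp (- s)], and
    [q <= 1 / (1 + s)] bounds it by [(2 + s) / s <= 3 / s]. With [s = rho / 2] this is
    the constant [6 / rho] of the lifespan. *)
Lemma finite_sums_le_exp_weight s : 0 < s <= 1 ->
  finite_sums_le (exp_weight (- s)) ((3 / s) ^+ nu).
Proof.
move=> /andP[s0 s1]; pose q := expR (- s).
have q0 : 0 < q by exact: expR_gt0.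
have s1' : 0 < 1 + s by rewrite addr_gt0.
have qs : q * (1 + s) <= 1.
  rewrite -ler_pdivlMr // /q expRN div1r lef_pV2 ?posrE ?expR_gt0 //.
  exact: expR_ge1Dx.
have q1 : q < 1.
  by rewrite -(ltr_pM2r s1') mul1r (le_lt_trans qs) // ltrDl.
have q01 : 0 <= q < 1 by rewrite (ltW q0).
have Qle : (1 + q) / (1 - q) <= 3 / s.
  rewrite ler_pdivrMr ?subr_gt0 // mulrAC ler_pdivlMr //.
  have : (s + 2 * q - 2) * (1 + s) <= 0.
    have : s * s <= s by rewrite ler_piMl // ltW.
    lra.
  by rewrite pmulr_lle0 //; lra.
have := @finite_sums_le_row _ (fun z : int => q ^+ `|z|%N) _ nu _ (finite_sums_le_int q01).
move=> /(_ (fun=> exprn_ge0 _ (ltW q0))); apply: finite_sums_le_mono => [n|].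
  by rewrite prodrXr /exp_weight -expRM_natr.
apply: lerXn2r => //; rewrite nnegrE divr_ge0 //; first by lra.
  by lra.
by lra.
Qed.

Variable omega : 'rV[R]_nu.

Lemma freq_exp_weight d : 0 < d ->
  exists2 C : R, 0 <= C & forall n, `|freq omega n| <= C * exp_weight d n.
Proof.
move=> d0; pose O := \sum_(j < nu) `|omega ord0 j|.
have O0 : 0 <= O by exact: sumr_ge0.
exists (O / d) => [|n]; first by rewrite divr_ge0 // ltW.
have h1 : `|freq omega n| <= O * (norm1 n)%:R.
  rewrite (le_trans (ler_norm_sum _ _ _)) // /O mulr_suml; apply: ler_sum => j _.
  rewrite normrM mulrC ler_wpM2l // -intr_norm -abszE -pmulrn.
  by rewrite ler_nat /norm1 (bigD1 j) //= leq_addr.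
apply: (le_trans h1); rewrite -mulrA ler_wpM2l // mulrC ler_pdivlMr // mulrC.
by apply: le_trans (expR_ge1Dx _); rewrite lerDr.
Qed.

(** The weight for one space derivative: being submultiplicative, it shows that
    convolution powers of a differentiable series are differentiable, without a
    Leibniz rule on coefficients. *)
Definition freq_weight (n : Z) : R := 1 + `|freq omega n|.

Lemma freq_weight_submultiplicative : submultiplicative_weight freq_weight.
Proof.
split=> [n|m n]; first by rewrite lerDl.
rewrite /freq_weight freqD.
have := ler_normD (freq omega m) (freq omega n).
have : 0 <= `|freq omega m| * `|freq omega n| by rewrite mulr_ge0.
by move=> ? ?; lra.
Qed.

End Decay.

(** * Linear evolution and Duhamel estimate *)

Section Duhamel.
Variable R : realType.

Lemma duhamel_solve (k L : R) (z0 : Cplx R) (h : R -> Cplx R) : 0 <= L ->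
  (forall t, continuous_on_at setT h t) ->
  exists z : R -> Cplx R, z 0 = z0 /\ forall t, segment0 L t ->
    derivative_at (segment0 L) z t (- toI k * z t + h t).
Proof.
move=> L0 ch.
have cg t : continuous_on_at setT (fun s => expi (k * s) * h s) t.
  apply: continuous_on_atM => //; apply: derivative_at_continuous.
  exact: derivative_at_expi.
have [F [F0 dF]] := antiderivative L0 cg.
exists (fun t => expi (- k * t) * (z0 + F t)); split.
  by rewrite mulr0 expi0 mul1r F0 addr0.
move=> t tL.
have := derivative_atM (derivative_at_expi (segment0 L) (- k) t)
  (derivative_atD (derivative_at_cst _ z0 t) (dF t tL)).
congr derivative_at; rewrite add0r toIN.
have -> : expi (- k * t) * (expi (k * t) * h t) = h t.
  by rewrite mulrA mulNr expiNK mul1r.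
by rewrite mulrA.
Qed.

(** The linear part multiplies each mode by a phase, so after removing the phase
    only the forcing contributes to the modulus. This is why the lifespan, which may be
    long, does not see the linear term of the equation. *)
Lemma duhamel_le (I : choiceType) (F : {fset I}) (w m : I -> R)
    (z h : R -> I -> Cplx R) (beta beta' : R -> R) (L : R) : 0 <= L ->
  (forall i, 0 <= w i) ->
  (forall t i, segment0 L t ->
     derivative_at (segment0 L) (z^~ i) t (- toI (m i) * z t i + h t i)) ->
  (forall t, segment0 L t -> is_derive t 1 beta (beta' t)) ->
  (forall t, segment0 L t -> \sum_(i <- F) w i * modulus (h t i) <= beta' t) ->
  forall t, segment0 L t ->
    \sum_(i <- F) w i * modulus (z t i) <=
    \sum_(i <- F) w i * modulus (z 0 i) + (beta t - beta 0).
Proof.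
move=> L0 w0 dz db hb t tL.
pose y t i : Cplx R := expi (m i * t) * z t i.
pose g t i : Cplx R := expi (m i * t) * h t i.
have dy s i : segment0 L s -> derivative_at (segment0 L) (y^~ i) s (g s i).
  move=> sL; have := derivative_atM (derivative_at_expi (segment0 L) (m i) s) (dz s i sL).
  by congr derivative_at; rewrite /g; ring.
have gb s : segment0 L s -> \sum_(i <- F) w i * modulus (g s i) <= beta' s.
  move=> /hb; under [X in _ -> X <= _]eq_bigr do rewrite modulusM modulus_expi mul1r.
  by [].
have := weighted_mean_value L0 w0 dy db gb tL.
under eq_bigr do rewrite modulusM modulus_expi mul1r.
by under [in X in _ <= X + _]eq_bigr do rewrite modulusM modulus_expi mul1r.
Qed.

End Duhamel.

(** * Geometric convergence *)

Section GeometricLimits.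
Variable R : realType.

Lemma half_pow_small (C e : R) : 0 <= C -> 0 < e -> exists k, C * 2^-1 ^+ k <= e.
Proof.
move=> C0 e0; have [k hk] : exists k : nat, C / e <= k%:R.
  by exists (Num.bound (C / e)); apply/ltW/archi_boundP; rewrite divr_ge0 // ltW.
exists k; rewrite exprVn ler_pdivrMr ?exprn_gt0 // mulrC -ler_pdivrMr //.
apply: (le_trans hk); rewrite -natrX ler_nat; exact/ltnW/ltn_expl.
Qed.

Lemma le0_half_pow (x C : R) : 0 <= C -> (forall k, x <= C * 2^-1 ^+ k) -> x <= 0.
Proof.
move=> C0 H; apply/ler_addgt0Pr => e e0; rewrite add0r.
have [k hk] := half_pow_small C0 e0; exact: le_trans (H k) hk.
Qed.

(** The limit is the sum of the increments; the increments from rank [k] on add up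
    to at most twice the bound on the increment of rank [k]. *)
Lemma geometric_cauchy_limit (x : nat -> Cplx R) (C : R) :
  (forall k, modulus (x k.+1 - x k) <= C * 2^-1 ^+ k) ->
  exists l, forall k, modulus (l - x k) <= 2 * C * 2^-1 ^+ k.
Proof.
move=> H; pose d i := x i.+1 - x i.
have C0 : 0 <= C by have := le_trans (modulus_ge0 _) (H 0%N); rewrite expr0 mulr1.
have half : 0 <= (2^-1 : R) < 1 by rewrite invr_ge0 ler0n /= invf_lt1 // ltr1n.
have geo := finite_sums_le_geometric half.
have half2 : (1 - 2^-1 : R)^-1 = 2 by field.
rewrite half2 in geo.
have dC : finite_sums_le (modulus \o d) (C * 2).
  have := finite_sums_leZ C0 geo; apply: finite_sums_le_mono => // i; exact: H.
have [S hS] := sums_to_exists dC; exists (x 0%N + S) => k.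
pose F0 : {fset nat} := [fset n in iota 0 k]%fset.
have sumF0 : \sum_(i <- F0) d i = x k - x 0%N.
  rewrite big_imfset //= undup_id ?iota_uniq // -[k in iota 0 k]subn0.
  by rewrite -/(index_iota 0 k) telescope_sumr.
have := @sums_to_remainder _ _ d S F0 (2 * C * 2^-1 ^+ k) hS _ F0 (fsubset_refl _).
rewrite sumF0 => HH; have {HH} := HH _.
have -> : x k - x 0%N - S = - (x 0%N + S - x k) by ring.
rewrite modulusN; apply => G FG.
have Gk i : i \in G -> (k <= i)%N.
  move=> iG; rewrite leqNgt; apply/negP => ik.
  have := fdisjointP FG i; rewrite !inE mem_iota /= add0n ik iG.
  by move=> /(_ isT).
have := geo ((fun i => (i - k)%N) @` G)%fset.
rewrite big_imfset /=; last first.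
  by move=> i j /Gk ki /Gk kj ij; rewrite -(subnK ki) -(subnK kj) ij.
move/(ler_wpM2l (mulr_ge0 C0 (exprn_ge0 k (proj1 (andP half))))).
have -> : C * 2^-1 ^+ k * 2 = 2 * C * 2^-1 ^+ k by ring.
apply: le_trans; rewrite mulr_sumr big_seq [leRHS]big_seq; apply: ler_sum => i /Gk ki.
by rewrite -mulrA -exprD subnKC //; exact: H.
Qed.

End GeometricLimits.

(** * The coefficient system and its Picard iteration *)

Section Clamp.
Variable R : realType.
Implicit Types (L s t : R).

(** Projection onto the time interval, by which a forcing given on that interval
    is extended continuously to all times. *)
Definition clamp L t := Num.max 0 (Num.min L t).

Lemma clamp_segment0 L t : 0 <= L -> segment0 L (clamp L t).
Proof. by move=> L0; rewrite /segment0 /clamp /= le_max lexx /= ge_max L0 ge_min lexx. Qed.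

Lemma clamp_id L t : segment0 L t -> clamp L t = t.
Proof. by move=> /andP[t0 tL]; rewrite /clamp (min_idPr tL) (max_idPr t0). Qed.

Lemma clamp_dist L s t : 0 <= L -> `|clamp L s - clamp L t| <= `|s - t|.
Proof.
move=> L0.
have cl x : [\/ x < 0 /\ clamp L x = 0, L < x /\ clamp L x = L |
    (0 <= x /\ x <= L) /\ clamp L x = x].
  have [x0|x0] := ltP x 0; last have [xL|xL] := ltP L x.
  - by constructor 1; rewrite /clamp (min_idPr _) ?(max_idPl _) ?ltW // (lt_le_trans x0).
  - by constructor 2; rewrite /clamp (min_idPl (ltW xL)) (max_idPr L0).
  - by constructor 3; rewrite clamp_id // /segment0 /= x0.
have h1 := ler_norm (s - t); have h2 := ler_norm (t - s); rewrite distrC in h2.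
by rewrite ler_norml; case: (cl s) => [[? ->]|[? ->]|[[? ?] ->]];
  case: (cl t) => [[? ->]|[? ->]|[[? ?] ->]]; apply/andP; split; lra.
Qed.

Lemma continuous_clamp L (f : R -> Cplx R) : 0 <= L ->
  (forall t, segment0 L t -> continuous_on_at (segment0 L) f t) ->
  forall t, continuous_on_at setT (f \o clamp L) t.
Proof.
move=> L0 cf t e e0; have [d d0 H] := cf _ (clamp_segment0 t L0) e e0.
exists d => // s _ sd; apply: H; first exact: clamp_segment0.
exact: le_lt_trans (clamp_dist s t L0) sd.
Qed.

End Clamp.

Section CoefficientSystem.
Variables (R : realType) (nu : nat) (omega : 'rV[R]_nu) (q : nat).
Local Notation Z := 'rV[int]_nu.

(** The Fourier symbol of [(1 - d^2)^-1 d] is [i symbol n]. The equation becomes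
    [u_t = - (1 - d^2)^-1 d (u + u^p / p)]; the symbol is bounded, so this is an
    ordinary differential equation in a Banach algebra. *)
Definition symbol (n : Z) : R := freq omega n / (1 + freq omega n ^+ 2).

Lemma symbol_le n : `|symbol n| <= 2^-1.
Proof.
have h : 0 < 1 + freq omega n ^+ 2 by rewrite ltr_pwDl // sqr_ge0.
rewrite /symbol normrM normfV (gtr0_norm h) ler_pdivrMr // ler_norml.
have := sqr_ge0 (freq omega n - 1); have := sqr_ge0 (freq omega n + 1).
by move=> ? ?; apply/andP; split; lra.
Qed.

(** Coefficients of [u^p], where [p = q + 1]. *)
Definition conv_power (a : Z -> Cplx R) : Z -> Cplx R := iter q (cauchy_product a) a.

Definition forcing (a : Z -> Cplx R) (n : Z) : Cplx R :=
  - toI (symbol n) * (toC q.+1%:R^-1 * conv_power a n).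

Definition rhs (a : Z -> Cplx R) (n : Z) : Cplx R :=
  - toI (symbol n) * a n + forcing a n.

Lemma modulus_symbol n (z : Cplx R) : modulus (- toI (symbol n) * z) <= 2^-1 * modulus z.
Proof. by rewrite modulusM modulusN modulus_toI ler_wpM2r ?modulus_ge0 ?symbol_le. Qed.

Let p_ge0 : 0 <= (q.+1%:R^-1 : R). Proof. by rewrite invr_ge0. Qed.

Lemma forcing_weighted_l1_le W a r : submultiplicative_weight W ->
  weighted_l1_le W a r ->
  weighted_l1_le W (forcing a) (r ^+ q.+1 / (2 * q.+1%:R)).
Proof.
move=> Wsub ar; have W0 := weight_ge0 Wsub.
have c0 : 0 <= 2^-1 * q.+1%:R^-1 :> R by rewrite mulr_ge0 // invr_ge0.
have := finite_sums_leZ c0 (conv_iter_weighted_l1_le q Wsub ar ar).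
apply: finite_sums_le_mono => [n|]; last by rewrite -exprSr invfM mulrC.
rewrite mulrCA ler_wpM2l // /forcing (le_trans (modulus_symbol _ _)) //.
by rewrite modulusM modulus_toC ger0_norm // mulrA.
Qed.

Lemma forcing_lipschitz W a b r d : submultiplicative_weight W ->
  weighted_l1_le W a r -> weighted_l1_le W b r ->
  weighted_l1_le W (fun n => a n - b n) d ->
  weighted_l1_le W (fun n => forcing a n - forcing b n) (r ^+ q * d / 2).
Proof.
move=> Wsub ar br ab; have W0 := weight_ge0 Wsub.
have c0 : 0 <= 2^-1 * q.+1%:R^-1 :> R by rewrite mulr_ge0 // invr_ge0.
have := finite_sums_leZ c0 (conv_iter_lipschitz q Wsub ar br ab).
apply: finite_sums_le_mono => [n|]; last first.
  by rewrite le_eqVlt; apply/orP; left; apply/eqP; field.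
rewrite mulrCA ler_wpM2l // /forcing -mulrBr -mulrBr.
rewrite (le_trans (modulus_symbol _ _)) //.
by rewrite modulusM modulus_toC ger0_norm // mulrA.
Qed.

Section Picard.
Variables (W : Z -> R) (Q K r L : R) (u0 : Z -> Cplx R).
Hypothesis Wsub : submultiplicative_weight W.
Hypothesis WQ : finite_sums_le (fun n => (W n)^-1) Q.
Hypothesis L0 : 0 <= L.
Hypothesis u0K : weighted_l1_le W u0 K.
Hypothesis r0 : 0 <= r.
Hypothesis ball_stable : K + L * (r ^+ q.+1 / (2 * q.+1%:R)) <= r.
Hypothesis contractive : L * r ^+ q <= 1.

(** Membership in the closed ball of radius [r] of the space of continuous curves
    on the time interval; continuity is only required coefficientwise. *)
Definition in_ball (U : R -> Z -> Cplx R) :=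
  (forall t, segment0 L t -> weighted_l1_le W (U t) r) /\
  (forall t n, segment0 L t -> continuous_on_at (segment0 L) (U^~ n) t).

(** The next iterate [V] solves the linear equation forced by the current one [U];
    keeping the linear part implicit lets the phase-free estimate apply to it. *)
Definition picard_step (U V : R -> Z -> Cplx R) :=
  (forall n, V 0 n = u0 n) /\
  forall t n, segment0 L t ->
    derivative_at (segment0 L) (V^~ n) t (- toI (symbol n) * V t n + forcing (U t) n).

Let W0 := weight_ge0 Wsub.
Let Wgt0 n : 0 < W n. Proof. exact: lt_le_trans ltr01 (Wsub.1 n). Qed.

Lemma weighted_l1_le_pointwise a M n : weighted_l1_le W a M -> modulus (a n) <= M / W n.
Proof.
move=> aM; rewrite ler_pdivlMr // mulrC; exact: finite_sums_le_term aM.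
Qed.

(** The summability of the inverse weight provides a majorant independent of time,
    hence uniform convergence of the convolution sum. *)
Lemma continuous_conv (A B : R -> Z -> Cplx R) M N :
  (forall t, segment0 L t -> weighted_l1_le W (A t) M) ->
  (forall t n, segment0 L t -> continuous_on_at (segment0 L) (A^~ n) t) ->
  (forall t, segment0 L t -> weighted_l1_le W (B t) N) ->
  (forall t n, segment0 L t -> continuous_on_at (segment0 L) (B^~ n) t) ->
  forall t n, segment0 L t ->
    continuous_on_at (segment0 L) (fun s => cauchy_product (A s) (B s) n) t.
Proof.
move=> AM cA BN cB t n tL.
have M0 : 0 <= M by exact: finite_sums_le_ge0 (AM t tL).
have N0 : 0 <= N by exact: finite_sums_le_ge0 (BN t tL).
apply: (@continuous_on_at_sums_to _ _ _ (fun s m => A s (n - m) * B s m)) => //.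
- by move=> m; apply: continuous_on_atM; [exact: cA|exact: cB].
- apply: (@small_tails_dominated _ _ _ _ _ (fun m => M * N * (W m)^-1) (M * N * Q)).
  + by move=> m; rewrite mulr_ge0 ?mulr_ge0 // invr_ge0.
  + move=> s m sL; rewrite modulusM -mulrA; apply: ler_pM; rewrite ?modulus_ge0 //.
      exact: (finite_sums_le_term (n - m) (weighted_l1_le_modulus Wsub (AM s sL))).
    exact: weighted_l1_le_pointwise (BN s sL).
  + by apply: finite_sums_leZ => //; exact: mulr_ge0.
move=> s sL; apply: conv_sums_to; apply: weighted_l1_le_modulus Wsub _.
  exact: AM. exact: BN.
Qed.

Lemma continuous_conv_power U : in_ball U -> forall t n, segment0 L t ->
  continuous_on_at (segment0 L) (fun s => conv_power (U s) n) t.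
Proof.
move=> [Ur cU]; rewrite /conv_power; elim: q => [|j IH]; first exact: cU.
apply: (continuous_conv (M := r) (N := r ^+ j * r)) => // t tL.
by apply: conv_iter_weighted_l1_le => //; exact: Ur.
Qed.

Lemma continuous_forcing U : in_ball U -> forall t n, segment0 L t ->
  continuous_on_at (segment0 L) (fun s => forcing (U s) n) t.
Proof.
move=> Ub t n tL; rewrite /forcing.
do 2! (apply: continuous_on_atM; first exact: continuous_on_at_cst).
exact: continuous_conv_power.
Qed.

Lemma continuous_rhs U : in_ball U -> forall t n, segment0 L t ->
  continuous_on_at (segment0 L) (fun s => rhs (U s) n) t.
Proof.
move=> Ub t n tL; apply: continuous_on_atD; last exact: continuous_forcing.
apply: continuous_on_atM; first exact: continuous_on_at_cst.
exact: Ub.2.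
Qed.

Lemma picard_step_exists U : in_ball U -> exists V, picard_step U V.
Proof.
move=> Ub.
have cont n t : continuous_on_at setT ((fun s => forcing (U s) n) \o clamp L) t.
  by apply: continuous_clamp => // {}t tL; exact: continuous_forcing.
have [z hz] := choice (fun n => duhamel_solve (symbol n) (u0 n) L0 (cont n)).
exists (fun t n => z n t); split=> [n|t n tL]; first by have [] := hz n.
by have [_ /(_ t tL)] := hz n; rewrite /= clamp_id.
Qed.

Lemma picard_step_ball U V : in_ball U -> picard_step U V -> in_ball V.
Proof.
move=> [Ur cU] [V0 dV]; split=> [t tL F|t n tL]; last first.
  exact: derivative_at_continuous (dV t n tL).
have /andP[t0 tL'] := tL.
have fU s (sL : segment0 L s) := forcing_weighted_l1_le Wsub (Ur s sL) F.
have := duhamel_le L0 W0 dV (fun s _ => is_derive_linear _ s) fU tL.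
move/le_trans; apply; apply: le_trans ball_stable; apply: lerD.
  by under eq_bigr do rewrite V0; exact: u0K.
rewrite mulr0 subr0 mulrC ler_wpM2r //.
exact: finite_sums_le_ge0 (forcing_weighted_l1_le Wsub (Ur t tL)).
Qed.

(** The forcing is Lipschitz with constant [r^q / 2], since the symbol is at most
    [1 / 2]; over a time at most [L] with [L r^q <= 1] this leaves [1 / 2]. *)
Lemma picard_step_contraction U V U' V' d : in_ball U -> in_ball U' ->
  picard_step U V -> picard_step U' V' ->
  (forall t, segment0 L t -> weighted_l1_le W (fun n => U t n - U' t n) d) ->
  forall t, segment0 L t -> weighted_l1_le W (fun n => V t n - V' t n) (2^-1 * d).
Proof.
move=> [Ur _] [Ur' _] [V0 dV] [V0' dV'] UUd t tL F.
have /andP[t0 tL'] := tL.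
have d0 : 0 <= d by exact: finite_sums_le_ge0 (UUd t tL).
have dz s n : segment0 L s ->
    derivative_at (segment0 L) (fun x => V x n - V' x n) s
      (- toI (symbol n) * (V s n - V' s n) + (forcing (U s) n - forcing (U' s) n)).
  move=> sL; have := derivative_atB (dV s n sL) (dV' s n sL).
  by congr derivative_at; ring.
have fU s (sL : segment0 L s) :=
  forcing_lipschitz Wsub (Ur s sL) (Ur' s sL) (UUd s sL) F.
have := duhamel_le (z := fun s n => V s n - V' s n) L0 W0 dz (fun s _ => is_derive_linear _ s) fU tL.
move/le_trans; apply; rewrite big1 ?add0r => [|n _]; last first.
  by rewrite V0 V0' subrr modulus0 mulr0.
have r0q : 0 <= r ^+ q by exact: exprn_ge0.
have trq : t * r ^+ q <= 1 by apply: le_trans contractive; rewrite ler_wpM2r.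
rewrite mulr0 subr0.
have -> : r ^+ q * d / 2 * t = t * r ^+ q * (2^-1 * d) by field.
by rewrite ler_piMl // mulr_ge0.
Qed.

(** Banach fixed point argument, written out on coefficients: the iterates converge
    geometrically in the weighted norm, uniformly in time, and one further step from
    the limit gives back the limit, which is therefore differentiable. *)
Lemma coefficient_solution_exists : exists U : R -> Z -> Cplx R,
  [/\ forall n, U 0 n = u0 n, in_ball U &
      forall t n, segment0 L t -> derivative_at (segment0 L) (U^~ n) t (rhs (U t) n)].
Proof.
have Kr : K <= r.
  apply: le_trans ball_stable; rewrite lerDl mulr_ge0 // divr_ge0 ?exprn_ge0 //.
have /choice[Phi hPhi] : forall U, exists V, in_ball U -> picard_step U V.
  move=> U; have [Ub|nUb] := pselect (in_ball U); last by exists U.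
  by have [V hV] := picard_step_exists Ub; exists V.
pose Us k := iter k Phi (fun _ : R => u0).
have Usb k : in_ball (Us k).
  elim: k => [|k IH]; last exact: picard_step_ball IH (hPhi _ IH).
  split=> [t _|t n _]; first exact: finite_sums_le_mono u0K.
  exact: derivative_at_continuous (derivative_at_cst _ _ _).
have Us_step k : picard_step (Us k) (Us k.+1) by exact: hPhi.
have dUs k t : segment0 L t ->
    weighted_l1_le W (fun n => Us k.+1 t n - Us k t n) (2 * r * 2^-1 ^+ k).
  elim: k t => [|k IH] t tL.
    have := weighted_l1_leD W0 ((Usb 1%N).1 t tL) (weighted_l1_leN ((Usb 0%N).1 t tL)).
    by apply: finite_sums_le_mono => //; rewrite expr0 mulr1 mulr_natl mulr2n.
  have := picard_step_contraction (Usb k.+1) (Usb k) (Us_step k.+1) (Us_step k) IH tL.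
  by apply: finite_sums_le_mono => //; rewrite exprS mulrCA.
have gcl t n : exists l, segment0 L t ->
    forall k, modulus (l - Us k t n) <= 2 * (2 * r) * 2^-1 ^+ k.
  have [tL|ntL] := pselect (segment0 L t); last by exists 0.
  have [|l hl] := @geometric_cauchy_limit _ (fun k => Us k t n) (2 * r).
    move=> k; exact: (finite_sums_le_term n (weighted_l1_le_modulus Wsub (dUs k t tL))).
  by exists l.
have [U hU] : exists U, forall t n, segment0 L t ->
    forall k, modulus (U t n - Us k t n) <= 2 * (2 * r) * 2^-1 ^+ k.
  by exists (fun t => projT1 (choice (gcl t))) => t; exact: projT2 (choice (gcl t)).
(* 2 r bounds the first increment, and the increments halve. *)
pose C := 4 * r.
have C0 : 0 <= C by exact: mulr_ge0.
have hUC t n k : segment0 L t -> modulus (U t n - Us k t n) <= C * 2^-1 ^+ k.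
  by move=> tL; have := hU t n tL k; rewrite mulrA -natrM.
have tele t k i : segment0 L t ->
    weighted_l1_le W (fun n => Us (k + i)%N t n - Us k t n)
      (C * 2^-1 ^+ k * (1 - 2^-1 ^+ i)).
  move=> tL; elim: i => [|i IH].
    rewrite addn0 expr0 subrr mulr0 => F; rewrite big1 // => n _.
    by rewrite subrr modulus0 mulr0.
  have := weighted_l1_leD W0 (dUs (k + i)%N t tL) IH.
  apply: finite_sums_le_mono => [n|]; last first.
    by rewrite exprD exprS /C le_eqVlt; apply/orP; left; apply/eqP; field.
  by rewrite addnS addrA subrK.
have UsU t k : segment0 L t -> weighted_l1_le W (fun n => U t n - Us k t n) (C * 2^-1 ^+ k).
  move=> tL F; rewrite -subr_le0.
  have WF0 : 0 <= \sum_(n <- F) W n by exact: sumr_ge0.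
  apply: (@le0_half_pow _ _ ((\sum_(n <- F) W n) * C)); first exact: mulr_ge0.
  move=> i; have h1 := tele t k i tL F.
  have pk0 j : 0 <= (2^-1 : R) ^+ j by rewrite exprn_ge0 // invr_ge0.
  have pk1 j : (2^-1 : R) ^+ j <= 1.
    by rewrite exprn_ile1 ?invr_ge0 // invf_le1 // ler1n.
  have h2 : \sum_(n <- F) W n * modulus (U t n - Us (k + i)%N t n) <=
     (\sum_(n <- F) W n) * C * 2^-1 ^+ i.
    rewrite -mulrA mulr_suml; apply: ler_sum => n _; rewrite ler_wpM2l //.
    apply: (le_trans (hUC t n (k + i)%N tL)); rewrite ler_wpM2l // exprD.
    by rewrite ler_piMl.
  rewrite lerBlDr.
  have h3 : C * 2^-1 ^+ k * (1 - 2^-1 ^+ i) <= C * 2^-1 ^+ k.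
    by rewrite ler_piMr ?mulr_ge0 // gerBl.
  apply: le_trans (lerD h2 (le_trans h1 h3)); rewrite -big_split /=.
  apply: ler_sum => n _; rewrite -mulrDr ler_wpM2l // (le_trans _ (modulusD _ _)) //.
  by rewrite addrA subrK.
have Ub : in_ball U.
  split=> [t tL F|t n tL].
    rewrite -subr_le0; apply: (le0_half_pow C0) => k.
    have h1 := UsU t k tL F; have h2 := (Usb k).1 t tL F.
    rewrite lerBlDr; apply: le_trans (lerD h1 h2); rewrite -big_split /=.
    by apply: ler_sum => n _; rewrite -mulrDr ler_wpM2l // (le_trans _ (modulusD _ _)) // subrK.
  move=> e e0; have e30 : 0 < e / 3 by rewrite divr_gt0.
  have [k hk] := half_pow_small C0 e30.
  have [d d0 H] := (Usb k).2 t n tL _ e30.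
  exists d => // s sL /(H s sL) h.
  have h1 := le_trans (hUC s n k sL) hk; have h2 := le_trans (hUC t n k tL) hk.
  have -> : U s n - U t n = (U s n - Us k s n) + (Us k s n - Us k t n) - (U t n - Us k t n).
    by ring.
  rewrite (le_trans (modulusD _ _)) // modulusN (le_trans (lerD (modulusD _ _) (lexx _))) //.
  lra.
have [V hV] := picard_step_exists Ub.
have VU t : segment0 L t -> V t = U t.
  move=> tL; apply/funext => n; apply/eqP; rewrite -subr_eq0; apply/eqP/modulus_eq0/eqP.
  rewrite eq_le modulus_ge0 andbT; apply: (@le0_half_pow _ _ (2 * C)) => [|k].
    by rewrite mulr_ge0.
  have h1 := finite_sums_le_term n (weighted_l1_le_modulus Wsub
    (picard_step_contraction Ub (Usb k) hV (Us_step k) (fun t tL => UsU t k tL) tL)).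
  have h2 := hUC t n k.+1 tL.
  have -> : V t n - U t n = (V t n - Us k.+1 t n) - (U t n - Us k.+1 t n) by ring.
  rewrite (le_trans (modulusD _ _)) // modulusN (le_trans (lerD h1 h2)) //.
  have c0 : 0 <= C * 2^-1 ^+ k by rewrite mulr_ge0 // exprn_ge0 // invr_ge0.
  rewrite exprS; lra.
exists V; split; first exact: hV.1.
  exact: picard_step_ball Ub hV.
by move=> t n tL; rewrite /rhs {2}VU //; exact: hV.2.
Qed.

End Picard.
End CoefficientSystem.

(** * Quasi-periodic series and the equation satisfied by their coefficients *)

Section QuasiPeriodicSeries.
Variables (R : realType) (nu : nat) (omega : 'rV[R]_nu).
Local Notation Z := 'rV[int]_nu.
Local Notation i_freq := (ifreq omega).

Lemma modulus_mode_coefficient (c : Z -> Cplx R) x :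
  modulus \o (fun n => c n * mode omega n x) = modulus \o c.
Proof. by apply/funext => n /=; rewrite modulusM modulus_mode mulr1. Qed.

Lemma qp_sums_to (c : Z -> Cplx R) M x : finite_sums_le (modulus \o c) M ->
  sums_to (fun n => c n * mode omega n x) (qp_series omega c x).
Proof.
move=> cM; have [s hs] := @sums_to_exists _ _ (fun n => c n * mode omega n x) M
  (eq_rect_r (fun f => finite_sums_le f M) cM (modulus_mode_coefficient c x)).
by rewrite /qp_series (sums_to_sum hs).
Qed.

Lemma qp_series_eq (c : Z -> Cplx R) s x :
  sums_to (fun n => c n * mode omega n x) s -> qp_series omega c x = s.
Proof. exact: sums_to_sum. Qed.

(** At [x = 0] all modes equal 1, so the tails of the coefficients are seen there. *)
Lemma cvg_abs_unif_small_tails L (c : R -> Z -> Cplx R) f :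
  cvg_abs_unif omega L c f ->
  small_tails (segment0 L) (fun t n => modulus (c t n)) /\
  forall t x, segment0 L t -> f t x = qp_series omega (c t) x.
Proof.
move=> [_ /uniform_cvg_partial_sums H]; split.
  have H0 := small_tails_uniform H => e /H0[F0 HF].
  exists F0 => t G tL FG; have := HF (t, 0) G tL FG.
  by under eq_bigr do rewrite mode0 mulr1.
move=> t x tL; symmetry; apply: qp_series_eq => e /H[F0 HF].
by exists F0 => F FF; exact: (HF F (t, x)).
Qed.

Lemma small_tails_cvg_abs_unif L (c : R -> Z -> Cplx R) :
  small_tails (segment0 L) (fun t n => modulus (c t n)) ->
  cvg_abs_unif omega L c (fun t => qp_series omega (c t)).
Proof.
move=> tails.
have bnd t : segment0 L t -> exists M, finite_sums_le (modulus \o c t) M.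
  by move=> tL; apply: (small_tails_bounded _ tails tL) => n; exact: modulus_ge0.
split=> [t x tL|].
  have [M cM] := bnd t tL.
  apply: (@summable_finite_sums _ _ _ M) => [n|]; first exact: modulus_ge0.
  by have := cM; rewrite -(modulus_mode_coefficient _ x).
apply/(@uniform_cvg_partial_sums R (R * R)%type _ [set z | 0 <= z.1 <= L]
  (fun z n => c z.1 n * mode omega n z.2) (fun z => qp_series omega (c z.1) z.2)).
move=> e e0; have [F0 HF] := tails e e0; exists F0 => F [t x] FF tL.
have [M cM] := bnd t tL.
apply: (sums_to_remainder (qp_sums_to x cM)) FF => G FG.
by under eq_bigr do rewrite modulusM modulus_mode mulr1; exact: HF.
Qed.

Lemma qp_derivative_t L (c d : R -> Z -> Cplx R) t x :
  (forall s n, segment0 L s -> derivative_at (segment0 L) (c^~ n) s (d s n)) ->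
  small_tails (segment0 L) (fun s n => modulus (c s n)) ->
  small_tails (segment0 L) (fun s n => modulus (d s n)) ->
  segment0 L t ->
  derivative_at (segment0 L) (fun s => qp_series omega (c s) x) t
    (qp_series omega (d t) x).
Proof.
move=> dc ctail dtail tL.
have bnd (a : R -> Z -> Cplx R) s : small_tails (segment0 L) (fun s n => modulus (a s n)) ->
    segment0 L s -> sums_to (fun n => a s n * mode omega n x) (qp_series omega (a s) x).
  move=> atail sL; have [|M aM] := small_tails_bounded _ atail sL.
    by move=> n; exact: modulus_ge0.
  exact: qp_sums_to aM.
apply: (@derivative_at_sums_to _ _ _ (fun s n => c s n * mode omega n x)
  (fun s n => d s n * mode omega n x)) => //.
- exact: convex_segment0.
- move=> s n sL; rewrite mulrC; have := derivative_atZ (mode omega n x) (dc s n sL).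
  by under eq_fun do rewrite mulrC.
- by move=> e /dtail[F0 HF]; exists F0 => s G sL FG; under eq_bigr do
    rewrite modulusM modulus_mode mulr1; exact: HF.
- by move=> s sL; exact: bnd.
- exact: bnd.
Qed.

Lemma qp_derivative_x (c : Z -> Cplx R) M N x : finite_sums_le (modulus \o c) M ->
  finite_sums_le (modulus \o (fun n => i_freq n * c n)) N ->
  derivative_at setT (qp_series omega c) x (qp_series omega (fun n => i_freq n * c n) x).
Proof.
move=> cM cN.
apply: (@derivative_at_sums_to _ _ _ (fun y n => c n * mode omega n y)
  (fun y n => i_freq n * c n * mode omega n y)) => //.
- move=> y n _; have := derivative_atZ (c n) (derivative_at_mode omega setT n y).
  by rewrite mulrA [c n * _]mulrC.
- move=> e e0; have [F0 HF] := finite_sums_le_tail (fun n => modulus_ge0 (i_freq n * c n)) cN e0.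
  exists F0 => y G _ FG; under eq_bigr do rewrite modulusM modulus_mode mulr1; exact: HF.
- by move=> y _; exact: qp_sums_to cM.
- exact: qp_sums_to cN.
Qed.

Lemma setT_limit_point (x : R) d : 0 < d ->
  exists s, [/\ setT s, s != x & `|s - x| < d].
Proof.
move=> d0; exists (x + d / 2); have d20 : 0 < d / 2 by rewrite divr_gt0.
rewrite -subr_eq0 addrAC subrr add0r gt_eqF // gtr0_norm //; split=> //.
by rewrite ltr_pdivrMr // ltr_pMr // ltr1n.
Qed.

Lemma segment0_limit_point (L t : R) d : 0 < L -> segment0 L t -> 0 < d ->
  exists s, [/\ segment0 L s, s != t & `|s - t| < d].
Proof.
move=> L0 /andP[t0 tL] d0.
pose e := Num.min (L / 2) (d / 2).
have e0 : 0 < e by rewrite lt_min !divr_gt0.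
have eL : e <= L / 2 by rewrite ge_min lexx.
have ed : e < d by rewrite gt_min orbC ltr_pdivrMr // ltr_pMr // ltr1n.
have [tL2|tL2] := leP t (L / 2).
  exists (t + e); rewrite /segment0 /= -subr_eq0 addrAC subrr add0r gt_eqF //.
  by rewrite gtr0_norm //; split=> //; apply/andP; split; lra.
exists (t - e); rewrite /segment0 /= -subr_eq0 addrAC subrr add0r oppr_eq0 gt_eqF //.
by rewrite normrN gtr0_norm //; split=> //; apply/andP; split; lra.
Qed.

Variable q : nat.

Lemma freq_weight_bounds (c : Z -> Cplx R) M : weighted_l1_le (freq_weight omega) c M ->
  finite_sums_le (modulus \o c) M /\
  finite_sums_le (modulus \o (fun n => i_freq n * c n)) M.
Proof.
move=> cM; split; apply: finite_sums_le_mono cM => // n /=.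
  by rewrite ler_peMl ?modulus_ge0 // (freq_weight_submultiplicative omega).1.
by rewrite modulusM modulus_ifreq ler_wpM2r ?modulus_ge0 // lerDr.
Qed.

(** Both sides are [1 / p] times the derivative of [u^p]: on the right by termwise
    differentiation of the series of [u^p], on the left by the chain rule. *)
Lemma qp_nonlinear_term (a : Z -> Cplx R) N x : weighted_l1_le (freq_weight omega) a N ->
  qp_series omega a x ^+ q * qp_series omega (fun n => i_freq n * a n) x =
  toC q.+1%:R^-1 * qp_series omega (fun n => i_freq n * conv_power q a n) x.
Proof.
move=> aN; have [a0 a1] := freq_weight_bounds aN.
have pN := conv_iter_weighted_l1_le q (freq_weight_submultiplicative omega) aN aN.
have [p0 p1] := freq_weight_bounds pN.
have powE : qp_series omega (conv_power q a) = fun y => qp_series omega a y ^+ q.+1.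
  apply/funext => y; apply: qp_series_eq; rewrite exprSr.
  exact: (conv_iter_character _ (mode_character omega y) a0 a0 (qp_sums_to y a0)
    (qp_sums_to y a0)).
have := derivative_atX q (qp_derivative_x x a0 a1).
rewrite -powE => d1; have d2 := qp_derivative_x x p0 p1.
have := derivative_at_unique (@setT_limit_point x) d2 d1.
rewrite /conv_power => ->; rewrite mulrA -(toC_nat R q.+1) -toCM mulVf ?pnatr_eq0 //.
by rewrite toC1 mul1r.
Qed.

(** The coefficient of mode [n] in [u_t - u_xxt + u_x + u^(p-1) u_x]. *)
Definition residual (a d : Z -> Cplx R) (n : Z) : Cplx R :=
  d n - i_freq n ^+ 2 * d n + i_freq n * a n
  + toC q.+1%:R^-1 * (i_freq n * conv_power q a n).

(** Since [(i theta)^2 = - theta^2], the residual is [1 + theta^2] times the defect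
    of the ordinary differential equation. *)
Lemma residual_eq0 a d n : residual a d n = 0 <-> d n = rhs omega q a n.
Proof.
rewrite /residual /rhs /forcing mulrCA; set X := a n; set P := conv_power q a n.
pose T : Cplx R := toC (1 + freq omega n ^+ 2).
have h : 0 < 1 + freq omega n ^+ 2 by rewrite ltr_pwDl // sqr_ge0.
have T0 : T != 0 by rewrite -toC0 (inj_eq (@toC_inj R)) gt_eqF.
have i2 : i_freq n ^+ 2 = - toC (freq omega n ^+ 2).
  by apply/eqP; rewrite eq_complex; apply/andP; split; apply/eqP => /=; ring.
have iT : i_freq n = T * toI (symbol omega n).
  by apply/eqP; rewrite eq_complex; apply/andP; split; apply/eqP => /=;
    rewrite /symbol; field; rewrite gt_eqF.
have -> : d n - i_freq n ^+ 2 * d n + i_freq n * X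
    + i_freq n * (toC q.+1%:R^-1 * P) =
  T * (d n - (- toI (symbol omega n) * X + - toI (symbol omega n) * (toC q.+1%:R^-1 * P))).
  by rewrite i2 iT /T toCD toC1; ring.
split=> [/eqP|->]; last by rewrite subrr mulr0.
by rewrite mulf_eq0 (negPf T0) /= subr_eq0 => /eqP.
Qed.

Lemma residual_summable (a d : Z -> Cplx R) M N1 N2 :
  weighted_l1_le (freq_weight omega) a M ->
  finite_sums_le (modulus \o d) N1 ->
  finite_sums_le (modulus \o (fun n => i_freq n ^+ 2 * d n)) N2 ->
  exists K, finite_sums_le (modulus \o residual a d) K.
Proof.
move=> aM dN1 dN2; have [_ a1] := freq_weight_bounds aM.
have pN := conv_iter_weighted_l1_le q (freq_weight_submultiplicative omega) aM aM.
have [_ p1] := freq_weight_bounds pN.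
have h1 := finite_sums_leD (finite_sums_leD dN1 dN2) a1.
have := finite_sums_leD h1 (finite_sums_leZ (modulus_ge0 (toC q.+1%:R^-1)) p1).
move=> h; eexists; apply: finite_sums_le_mono (lexx _) h => n /=.
rewrite /residual -[modulus (toC _) * _]modulusM.
rewrite (le_trans (modulusD _ _)) // lerD // (le_trans (modulusD _ _)) // lerD //.
by rewrite (le_trans (modulusD _ _)) // modulusN.
Qed.

Lemma qp_equation (a d : Z -> Cplx R) M N1 N2 x :
  weighted_l1_le (freq_weight omega) a M ->
  finite_sums_le (modulus \o d) N1 ->
  finite_sums_le (modulus \o (fun n => i_freq n ^+ 2 * d n)) N2 ->
  sums_to (fun n => residual a d n * mode omega n x)
    (qp_series omega d x - qp_series omega (fun n => i_freq n ^+ 2 * d n) x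
     + qp_series omega (fun n => i_freq n * a n) x
     + qp_series omega a x ^+ q * qp_series omega (fun n => i_freq n * a n) x).
Proof.
move=> aM dN1 dN2; have [a0 a1] := freq_weight_bounds aM.
have pN := conv_iter_weighted_l1_le q (freq_weight_submultiplicative omega) aM aM.
have [p0 p1] := freq_weight_bounds pN.
rewrite (qp_nonlinear_term x aM).
have h1 := sums_toB (qp_sums_to x dN1) (qp_sums_to x dN2).
have h2 := sums_toD h1 (qp_sums_to x a1).
have := sums_toD h2 (sums_toZ (toC q.+1%:R^-1) (qp_sums_to x p1)).
by apply: sums_to_ext => n; rewrite /residual /conv_power; ring.
Qed.

End QuasiPeriodicSeries.

(** * Exponentially decaying coefficients and the lifespan *)

Section DecayingCoefficients.
Variables (R : realType) (nu : nat) (omega : 'rV[R]_nu).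
Local Notation Z := 'rV[int]_nu.

Lemma small_tails_exp_decay (T : Type) (D : set T) (c : T -> Z -> Cplx R) C s :
  0 < s <= 1 -> 0 <= C ->
  (forall t n, D t -> modulus (c t n) <= C * exp_weight (- s) n) ->
  small_tails D (fun t n => modulus (c t n)).
Proof.
move=> s01 C0 H; have h := finite_sums_leZ C0 (@finite_sums_le_exp_weight R nu _ s01).
apply: (small_tails_dominated _ H h) => n; rewrite mulr_ge0 //; exact/ltW/exp_weight_gt0.
Qed.

Lemma freq_exp_decay s : 0 < s -> exists2 C : R, 0 <= C & forall n,
  (1 + `|freq omega n|) ^+ 2 * exp_weight (- s) n <= C * exp_weight (- (s / 2)) n.
Proof.
(* Two factors of growth exp (s |n| / 4) use up half of the decay. *)
move=> s0; have s40 : 0 < s / 4 by rewrite divr_gt0.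
have [C C0 HC] := freq_exp_weight omega s40.
exists ((1 + C) ^+ 2) => [|n]; first by rewrite exprn_ge0 // addr_ge0.
have h : 1 + `|freq omega n| <= (1 + C) * exp_weight (s / 4) n.
  by rewrite mulrDl mul1r lerD // (exp_weight_submultiplicative nu (ltW s40)).1.
have h2 : (1 + `|freq omega n|) ^+ 2 <= ((1 + C) * exp_weight (s / 4) n) ^+ 2.
  by rewrite lerXn2r // ?nnegrE ?addr_ge0 // mulr_ge0 ?addr_ge0 // ltW // exp_weight_gt0.
apply: le_trans (ler_wpM2r (ltW (exp_weight_gt0 _ _)) h2) _.
rewrite exprMn -mulrA ler_wpM2l ?exprn_ge0 ?addr_ge0 // expr2 !exp_weightD.
by apply: exp_weight_le; lra.
Qed.

Lemma freq_power_le j n : (j <= 2)%N ->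
  modulus (ifreq omega n ^+ j) <= (1 + `|freq omega n|) ^+ 2.
Proof.
move=> j2; rewrite modulusX modulus_ifreq; set x := `|_|.
have x0 : 0 <= x by exact: normr_ge0.
apply: (@le_trans _ _ ((1 + x) ^+ j)).
  by rewrite lerXn2r ?nnegrE ?addr_ge0 // lerDr.
by apply: ler_weXn2l => //; rewrite lerDl.
Qed.

Lemma small_tails_freq_power (T : Type) (D : set T) (c : T -> Z -> Cplx R) C s j :
  0 < s <= 1 -> 0 <= C -> (j <= 2)%N ->
  (forall t n, D t -> modulus (c t n) <= C * exp_weight (- s) n) ->
  small_tails D (fun t n => modulus (ifreq omega n ^+ j * c t n)).
Proof.
move=> /andP[s0 s1] C0 j2 H; have [C' C'0 HC'] := freq_exp_decay s0.
apply: (@small_tails_exp_decay _ _ _ (C * C') (s / 2)) => [||t n Dt].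
- by apply/andP; split; lra.
- exact: mulr_ge0.
rewrite modulusM -mulrA; apply: le_trans (ler_wpM2l C0 (HC' n)).
rewrite mulrCA; apply: ler_pM; rewrite ?modulus_ge0 //.
  exact: freq_power_le.
exact: H.
Qed.

Lemma exp_decay_pointwise (s : R) (a : Z -> Cplx R) M n : 0 <= s ->
  weighted_l1_le (exp_weight s) a M -> modulus (a n) <= M * exp_weight (- s) n.
Proof.
move=> s0 aM; rewrite exp_weightN ler_pdivlMr ?exp_weight_gt0 // mulrC.
exact: (finite_sums_le_term n aM).
Qed.

Lemma weighted_l1_le_weaken (W W' : Z -> R) (a : Z -> Cplx R) M k : 0 <= k ->
  (forall n, W' n <= k * W n) -> weighted_l1_le W a M -> weighted_l1_le W' a (k * M).
Proof.
move=> k0 WW aM; have := finite_sums_leZ k0 aM; apply: finite_sums_le_mono => // n.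
by rewrite mulrA ler_wpM2r ?modulus_ge0.
Qed.

End DecayingCoefficients.

Section Lifespan.
Variables (R : realType) (nu q : nat) (A rho : R).
Hypotheses (q0 : (0 < q)%N) (A0 : 0 < A) (rho0 : 0 < rho).

Let B := A `^ q%:R^-1.
(** Bound of the initial data in the weight [exp (rho |n| / 2)]. *)
Definition data_size := B * (6 / rho) ^+ nu.
(** The radius [K p / (p - 1)], with [K] the size of the data, is the one for which
    the lifespan [L] satisfies [L r^(p-1) = 1]. *)
Definition ball_radius := data_size * (q.+1%:R / q%:R).

Let qR : 0 < q%:R :> R. Proof. by rewrite ltr0n. Qed.
Let B0 : 0 < B. Proof. exact: powR_gt0. Qed.

Lemma data_size_gt0 : 0 < data_size.
Proof. by rewrite mulr_gt0 // exprn_gt0 // divr_gt0. Qed.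

Lemma ball_radius_gt0 : 0 < ball_radius.
Proof. by rewrite mulr_gt0 ?data_size_gt0 // divr_gt0. Qed.

Lemma lifespan_ball_radius : lifespan q.+1 nu A rho * ball_radius ^+ q = 1.
Proof.
have BA : B ^+ q = A.
  by rewrite -powR_mulrn ?(ltW B0) // -powRrM mulVf ?gt_eqF // powRr1 // ltW.
have pE : 1 - q.+1%:R^-1 = (q.+1%:R / q%:R)^-1 :> R.
  by rewrite invf_div -natr1; field; rewrite gt_eqF // natr1 pnatr_eq0.
rewrite /lifespan /ball_radius /data_size pE [in RHS]/=.
set x := q.+1%:R / q%:R; have x0 : x != 0 by rewrite gt_eqF // divr_gt0.
rewrite [(_ * _ * x) ^+ _]exprMn [(B * _) ^+ _]exprMn BA -exprM.
rewrite [(nu * q)%N]mulnC exprVn [(6 / rho) ^+ _]expr_div_n /=.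
have y0 : 6 ^+ (q * nu) != 0 :> R by rewrite expf_neq0.
have z0 : rho ^+ (q * nu) != 0 by rewrite expf_neq0 // gt_eqF.
have xq0 : x ^+ q != 0 by rewrite expf_neq0.
move: (x ^+ q) (6 ^+ (q * nu)) (rho ^+ (q * nu)) xq0 y0 z0 => a b c a0 b0 c0.
by field; rewrite a0 b0 c0 gt_eqF.
Qed.

Lemma lifespan_gt0 : 0 < lifespan q.+1 nu A rho.
Proof.
have h := exprn_gt0 q ball_radius_gt0.
by rewrite -(pmulr_lgt0 _ h) lifespan_ball_radius.
Qed.

(** With [L r^q = 1] the left side is [K + r / (2 p) = K + K / (2 q)], and the radius is
    [K + K / q]. *)
Lemma ball_radius_stable :
  data_size + lifespan q.+1 nu A rho * (ball_radius ^+ q.+1 / (2 * q.+1%:R))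
  <= ball_radius.
Proof.
have -> : lifespan q.+1 nu A rho * (ball_radius ^+ q.+1 / (2 * q.+1%:R)) =
    lifespan q.+1 nu A rho * ball_radius ^+ q * (ball_radius / (2 * q.+1%:R)).
  by rewrite exprSr; ring.
rewrite lifespan_ball_radius mul1r.
have -> : ball_radius / (2 * q.+1%:R) = data_size / (2 * q%:R).
  by rewrite /ball_radius -natr1; field; rewrite gt_eqF // natr1 pnatr_eq0.
rewrite /ball_radius.
have -> : data_size * (q.+1%:R / q%:R) = data_size + data_size / q%:R.
  by rewrite -natr1; field; rewrite gt_eqF.
rewrite lerD2l ler_pM2l ?data_size_gt0 // lef_pV2 ?posrE ?mulr_gt0 //.
by rewrite ler_peMl // ?(ltW qR) // ler1n.
Qed.

(** Half of the decay rate is spent on the weight, the other half on summing. *)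
Lemma data_in_ball (uh0 : 'rV[int]_nu -> Cplx R) : rho <= 1 ->
  (forall n, modulus (uh0 n) <= B * expR (- rho * (norm1 n)%:R)) ->
  weighted_l1_le (exp_weight (rho / 2)) uh0 data_size.
Proof.
move=> rho1 H; have rho_gt0 := rho0.
have s01 : 0 < rho / 2 <= 1 by apply/andP; split; lra.
have := finite_sums_leZ (ltW B0) (@finite_sums_le_exp_weight R nu _ s01).
apply: finite_sums_le_mono => [n|]; last first.
  by rewrite /data_size; have -> : 3 / (rho / 2) = 6 / rho by field; rewrite gt_eqF.
apply: le_trans (ler_wpM2l (ltW (exp_weight_gt0 _ n)) (H n)) _.
rewrite mulrCA -[expR _]/(exp_weight (- rho) n) exp_weightD.
by have -> : rho / 2 - rho = - (rho / 2) by field.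
Qed.

End Lifespan.

(** * Existence *)

Section Existence.
Variables (R : realType) (nu : nat) (omega : 'rV[R]_nu) (q : nat).
Local Notation Z := 'rV[int]_nu.

(** Exponential weights absorb the powers of the frequency, so all the series of the
    definition have an exponentially decaying majorant independent of time; the
    equation then holds because its residual coefficients vanish. *)
Lemma classical_solution_of_coefficients (s L r : R) (u0 : Z -> Cplx R)
    (U : R -> Z -> Cplx R) : 0 < s <= 1 -> 0 <= L ->
  (forall n, U 0 n = u0 n) -> 
  (forall t, segment0 L t -> weighted_l1_le (exp_weight s) (U t) r) ->
  (forall t n, segment0 L t ->
     derivative_at (segment0 L) (U^~ n) t (rhs omega q (U t) n)) ->
  (forall t n, segment0 L t ->
     continuous_on_at (segment0 L) (fun t => rhs omega q (U t) n) t) ->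
  classical_qp_solution q.+1 omega u0 L (fun t => qp_series omega (U t)).
Proof.
move=> s01 L0 U0 Ur dU crhs; have /andP[s0 s1] := s01.
have segm0 : segment0 L 0 by rewrite /segment0 /= lexx.
have r0 : 0 <= r by exact: finite_sums_le_ge0 (Ur 0 segm0).
have Wsub := exp_weight_submultiplicative nu (ltW s0).
have W0 := weight_ge0 Wsub.
pose D t n := rhs omega q (U t) n.
pose rD := 2^-1 * r + r ^+ q.+1 / (2 * q.+1%:R).
have Dr t : segment0 L t -> weighted_l1_le (exp_weight s) (D t) rD.
  move=> tL; apply: weighted_l1_leD => //; last exact: forcing_weighted_l1_le (Ur t tL).
  have h2 : 0 <= 2^-1 :> R by rewrite invr_ge0.
  have := finite_sums_leZ h2 (Ur t tL).
  apply: finite_sums_le_mono => // n; rewrite mulrCA ler_wpM2l //; exact: modulus_symbol.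
have rD0 : 0 <= rD by exact: finite_sums_le_ge0 (Dr 0 segm0).
have Upt t n : segment0 L t -> modulus (U t n) <= r * exp_weight (- s) n.
  by move=> tL; apply: exp_decay_pointwise; [exact: ltW|exact: Ur].
have Dpt t n : segment0 L t -> modulus (D t n) <= rD * exp_weight (- s) n.
  by move=> tL; apply: exp_decay_pointwise; [exact: ltW|exact: Dr].
have tU := small_tails_exp_decay s01 r0 Upt.
have tD := small_tails_exp_decay s01 rD0 Dpt.
have tU1 := small_tails_freq_power omega s01 r0 (isT : (1 <= 2)%N) Upt.
have tU2 := small_tails_freq_power omega s01 r0 (isT : (2 <= 2)%N) Upt.
have tD2 := small_tails_freq_power omega s01 rD0 (isT : (2 <= 2)%N) Dpt.
have s40 : 0 < s / 4 by rewrite divr_gt0.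
have [C C0 HC] := freq_exp_weight omega s40.
(* A quarter of the rate leaves room for the growth of the frequency. *)
have Ufreq t : segment0 L t ->
    weighted_l1_le (exp_weight (s / 4)) (fun n => ifreq omega n * U t n) (C * r).
  move=> tL; have := finite_sums_leZ C0 (Ur t tL); apply: finite_sums_le_mono => // n.
  rewrite modulusM modulus_ifreq mulrA [leRHS]mulrA ler_wpM2r ?modulus_ge0 //.
  apply: le_trans (ler_wpM2l (ltW (exp_weight_gt0 _ n)) (HC n)) _.
  rewrite mulrCA exp_weightD ler_wpM2l //; apply: exp_weight_le; lra.
have Uw t : segment0 L t -> weighted_l1_le (exp_weight (s / 4)) (U t) r.
  move=> tL; apply: finite_sums_le_mono (Ur t tL) => // n.
  rewrite ler_wpM2r ?modulus_ge0 //; apply: exp_weight_le; lra.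
have Wsub4 := exp_weight_submultiplicative nu (ltW s40).
have tN : small_tails (segment0 L) (fun t n => modulus
    (iter q (cauchy_product (U t)) (fun n => ifreq omega n * U t n) n)).
  apply: (@small_tails_exp_decay _ _ _ _ _ (r ^+ q * (C * r)) (s / 4)).
  - by apply/andP; split; lra.
  - by rewrite mulr_ge0 ?exprn_ge0 // mulr_ge0.
  move=> t n tL; apply: exp_decay_pointwise; first exact: ltW.
  by apply: conv_iter_weighted_l1_le => //; [exact: Uw|exact: Ufreq].
have Ufw t : segment0 L t -> weighted_l1_le (freq_weight omega) (U t) ((1 + C) * r).
  move=> tL; apply: weighted_l1_le_weaken (Ur t tL); first by rewrite addr_ge0.
  move=> n; rewrite /freq_weight mulrDl mul1r lerD ?Wsub.1 //.
  apply: (le_trans (HC n)); rewrite ler_wpM2l //; apply: exp_weight_le; lra.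
pose U1 t n := ifreq omega n * U t n.
pose U2 t n := ifreq omega n ^+ 2 * U t n.
pose D2 t n := ifreq omega n ^+ 2 * D t n.
have bnd (c : R -> Z -> Cplx R) t : small_tails (segment0 L) (fun s n => modulus (c s n)) ->
    segment0 L t -> exists M, finite_sums_le (modulus \o c t) M.
  by move=> ct tL; apply: (small_tails_bounded _ ct tL) => n; exact: modulus_ge0.
exists U, D; split.
- move=> n; split=> [t tL|].
    by apply/has_derivative_inP; rewrite segment0E; exact: dU.
  by apply: continuous_within_segment0 => t tL; exact: crhs.
- exact: small_tails_cvg_abs_unif.
- split; eexists; apply: small_tails_cvg_abs_unif => //.
- exists (fun t => qp_series omega (D t)), (fun t => qp_series omega (U1 t)),
    (fun t => qp_series omega (U2 t)), (fun t => qp_series omega (D2 t)) => t x tL.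
  have [M0 hU0] := bnd _ t tU tL; have [M1 hU1] := bnd _ t tU1 tL.
  have [M2 hU2] := bnd _ t tU2 tL; have [N0 hD0] := bnd _ t tD tL.
  have [N2 hD2] := bnd _ t tD2 tL.
  split; try (apply/has_derivative_inP; rewrite ?segment0E).
  + exact: qp_derivative_t.
  + exact: qp_derivative_x hU0 hU1.
  + have := @qp_derivative_x _ _ omega (U1 t) M1 M2 x hU1.
    have -> : (fun n => ifreq omega n * U1 t n) = U2 t.
      by apply/funext => n; rewrite /U1 /U2 mulrA.
    by apply.
  + apply: qp_derivative_t => // z n zL; apply: derivative_atZ; exact: dU.
  have h := qp_equation q x (Ufw t tL) hD0 hD2.
  apply: (sums_to_unique h); apply: sums_to_ext (sums_to0 _) => n.
  by rewrite (proj2 (residual_eq0 omega q (U t) (D t) n)) ?mul0r.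
- move=> x; congr qp_series; exact/funext.
Qed.

End Existence.

(** * Uniqueness *)

Section Uniqueness.
Variables (R : realType) (nu : nat) (omega : 'rV[R]_nu) (q : nat) (L : R).
Local Notation Z := 'rV[int]_nu.
Hypothesis L0 : 0 < L.

Let segm0 : segment0 L 0.
Proof. by rewrite /segment0 /= lexx ltW. Qed.

Lemma continuous_bounded (f : R -> Cplx R) :
  (forall t, segment0 L t -> continuous_on_at (segment0 L) f t) ->
  exists M, forall t, segment0 L t -> modulus (f t) <= M.
Proof.
move=> cf; pose g := modulus \o (f \o clamp L).
have cg : continuous g.
  move=> t; apply/cvgrPdist_le => e e0.
  have [d d0 H] := continuous_clamp (ltW L0) cf t e0.
  apply: filterS (nbhsx_ballx t d d0) => s; rewrite /ball /= => st.
  by rewrite distrC (le_trans (modulus_dist _ _)) // H // distrC.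
have [c _ Hc] := EVT_max (ltW L0) (continuous_subspaceT (fun x => cg x)).
exists (g c) => t tL; have := Hc t; rewrite /g /= clamp_id //; apply.
by rewrite in_itv.
Qed.

(** Finitely many coefficients are bounded by compactness of the time interval, the
    others are controlled by the tails. *)
Lemma small_tails_uniform_bound (c : R -> Z -> Cplx R) :
  (forall t n, segment0 L t -> continuous_on_at (segment0 L) (c^~ n) t) ->
  small_tails (segment0 L) (fun t n => modulus (c t n)) ->
  exists M, forall t, segment0 L t -> finite_sums_le (modulus \o c t) M.
Proof.
move=> cc tails; have [F0 HF] := tails 1 ltr01.
have [B HB] := choice (fun n => continuous_bounded (fun t tL => cc t n tL)).
exists (\sum_(n <- F0) B n + 1) => t tL F.
apply: (le_trans (sum_fset_le (fun n => modulus_ge0 (c t n)) (fsubsetUr F0 F))).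
rewrite (sum_fset_split _ (fsubsetUl F0 F)) lerD //.
  by apply: ler_sum => n _; exact: HB.
by apply: HF => //; apply/fdisjointP => i iF; rewrite !inE iF.
Qed.

(** Gronwall in the unweighted l1 norm, where every classical solution is bounded.
    With [lam] above the Lipschitz constant of the forcing doubled, one application
    of the Duhamel estimate to the bound [c exp (lam t)] returns half of it. *)
Lemma coefficients_unique (U V : R -> Z -> Cplx R) :
  small_tails (segment0 L) (fun t n => modulus (U t n)) ->
  small_tails (segment0 L) (fun t n => modulus (V t n)) ->
  (forall n, U 0 n = V 0 n) ->
  (forall t n, segment0 L t ->
     derivative_at (segment0 L) (U^~ n) t (rhs omega q (U t) n)) ->
  (forall t n, segment0 L t ->
     derivative_at (segment0 L) (V^~ n) t (rhs omega q (V t) n)) ->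
  forall t n, segment0 L t -> U t n = V t n.
Proof.
move=> tU tV UV0 dU dV.
have [BU HBU] := small_tails_uniform_bound
  (fun t n tL => derivative_at_continuous (dU t n tL)) tU.
have [BV HBV] := small_tails_uniform_bound
  (fun t n tL => derivative_at_continuous (dV t n tL)) tV.
pose B := Num.max BU BV.
have Ub t : segment0 L t -> weighted_l1_le (fun=> 1) (U t) B.
  move=> tL; apply: finite_sums_le_mono (unit_weighted (HBU t tL)) => //.
  by rewrite le_max lexx.
have Vb t : segment0 L t -> weighted_l1_le (fun=> 1) (V t) B.
  move=> tL; apply: finite_sums_le_mono (unit_weighted (HBV t tL)) => //.
  by rewrite le_max lexx orbT.
have B0 : 0 <= B by exact: finite_sums_le_ge0 (Ub 0 segm0).
have uw := @unit_weight R nu.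
pose lam := B ^+ q + 1.
have Bq0 : 0 <= B ^+ q by exact: exprn_ge0.
have lam0 : 0 < lam by rewrite ltr_wpDl.
have dz s n : segment0 L s ->
    derivative_at (segment0 L) (fun x => U x n - V x n) s
      (- toI (symbol omega n) * (U s n - V s n)
       + (forcing omega q (U s) n - forcing omega q (V s) n)).
  move=> sL; have := derivative_atB (dU s n sL) (dV s n sL).
  by congr derivative_at; rewrite /rhs; ring.
have bound k t : segment0 L t ->
    weighted_l1_le (fun=> 1) (fun n => U t n - V t n)
      (2 * B * expR (lam * t) * 2^-1 ^+ k).
  elim: k t => [|k IH] t tL.
    have := weighted_l1_leD (fun=> ler01) (Ub t tL) (weighted_l1_leN (Vb t tL)).
    apply: finite_sums_le_mono => //; rewrite expr0 mulr1.
    have -> : B + B = 2 * B * 1 by ring.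
    rewrite ler_wpM2l ?mulr_ge0 // -expR0 ler_expR mulr_ge0 ?(ltW lam0) //.
    by case/andP: tL.
  move=> F.
  pose beta (s : R) := B * 2^-1 ^+ k * expR (lam * s).
  have dbeta s : segment0 L s -> is_derive s 1 beta (lam * beta s).
    move=> _; have h := is_derive1_comp (is_derive_expR (lam * s)) (is_derive_linear lam s).
    have h' := is_deriveZ (B * 2^-1 ^+ k) h.
    by apply: (is_derive_eq h'); rewrite /GRing.scale /beta /=; ring.
  have pk0 : 0 <= (2^-1 : R) ^+ k by rewrite exprn_ge0 // invr_ge0.
  have beta0 s : 0 <= beta s by rewrite mulr_ge0 ?mulr_ge0 // ltW ?expR_gt0.
  have fb s : segment0 L s -> \sum_(n <- F) 1 *
      modulus (forcing omega q (U s) n - forcing omega q (V s) n) <= lam * beta s.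
    move=> sL; have := forcing_lipschitz omega q uw (Ub s sL) (Vb s sL) (IH s sL).
    move=> /(_ F)/le_trans; apply.
    have -> : B ^+ q * (2 * B * expR (lam * s) * 2^-1 ^+ k) / 2 = B ^+ q * beta s.
      by rewrite /beta; field.
    by rewrite ler_wpM2r // /lam lerDl.
  have := duhamel_le (z := fun s n => U s n - V s n) (w := fun=> 1) (F := F)
    (ltW L0) (fun=> ler01) dz dbeta fb tL.
  move/le_trans; apply; rewrite big1 ?add0r => [|n _]; last first.
    by rewrite UV0 subrr modulus0 mulr0.
  apply: (@le_trans _ _ (beta t)); first by rewrite gerBl.
  by rewrite /beta exprS le_eqVlt; apply/orP; left; apply/eqP; field.
move=> t n tL; apply/eqP; rewrite -subr_eq0; apply/eqP/modulus_eq0/eqP.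
rewrite eq_le modulus_ge0 andbT.
apply: (@le0_half_pow _ _ (2 * B * expR (lam * t))) => [|k].
  by rewrite mulr_ge0 ?mulr_ge0 // ltW // expR_gt0.
have := finite_sums_le_term n (bound k t tL); by rewrite mul1r.
Qed.

(** The coefficients of an arbitrary classical solution solve the coefficient
    system: the derivatives occurring in the equation are identified with the
    termwise ones, and the resulting series identity is read off mode by mode. *)
Lemma classical_solution_coefficients (u0 : Z -> Cplx R) (v : R -> R -> Cplx R) B s :
  rationally_independent omega -> 0 < s <= 1 -> 0 <= B ->
  (forall n, modulus (u0 n) <= B * exp_weight (- s) n) ->
  classical_qp_solution q.+1 omega u0 L v ->
  exists V : R -> Z -> Cplx R,
    [/\ small_tails (segment0 L) (fun t n => modulus (V t n)),
        forall t x, segment0 L t -> v t x = qp_series omega (V t) x,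
        forall n, V 0 n = u0 n &
        forall t n, segment0 L t ->
          derivative_at (segment0 L) (V^~ n) t (rhs omega q (V t) n)].
Proof.
move=> ind s01 B0 u0B [V [D [dV cV [[D_ cD] [V1_ cV1] [D2_ cD2] _] [ut [ux [uxx [uxxt pde]]]] v0]]].
have {}dV t n : segment0 L t -> derivative_at (segment0 L) (V^~ n) t (D t n).
  by move=> tL; rewrite -segment0E; apply/has_derivative_inP; exact: (dV n).1.
have [tV vE] := cvg_abs_unif_small_tails cV.
have [tD _] := cvg_abs_unif_small_tails cD.
have [tV1 _] := cvg_abs_unif_small_tails cV1.
have [tD2 _] := cvg_abs_unif_small_tails cD2.
have bnd (c : R -> Z -> Cplx R) t : small_tails (segment0 L) (fun s n => modulus (c s n)) ->
    segment0 L t -> exists M, finite_sums_le (modulus \o c t) M.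
  by move=> ct tL; apply: (small_tails_bounded _ ct tL) => n; exact: modulus_ge0.
have u0B' (t : R) n : segment0 L t -> modulus (u0 n) <= B * exp_weight (- s) n by [].
have tu0 := @small_tails_exp_decay R nu R _ (fun=> u0) _ _ s01 B0 u0B'.
have tu02 := @small_tails_freq_power R nu omega R _ (fun=> u0) _ _ 2%N s01 B0 isT u0B'.
have V0 n : V 0 n = u0 n.
  have [M hM] := bnd _ 0 tV segm0; have [N hN] := bnd _ 0 tu0 segm0.
  apply/eqP; rewrite -subr_eq0; apply/eqP.
  apply: (@fourier_coefficients_unique _ _ omega (fun n => V 0 n - u0 n) (M + N)) => //.
    have := finite_sums_leD hM hN; apply: finite_sums_le_mono => // m /=.
    by rewrite (le_trans (modulusD _ _)) // modulusN.
  move=> x; have := sums_toB (qp_sums_to omega x hM) (qp_sums_to omega x hN).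
  rewrite -vE // v0 subrr; apply: sums_to_ext => m; ring.
pose V2 t n := ifreq omega n ^+ 2 * V t n.
have mfreq n (z : Cplx R) : modulus (ifreq omega n ^+ 2 * z) = freq omega n ^+ 2 * modulus z.
  by rewrite modulusM modulusX modulus_ifreq real_normK // num_real.
(* The series of u_xx is not among the hypotheses: its convergence follows from
   that of its time derivative, because at time 0 the coefficients decay. *)
have tV2 : small_tails (segment0 L) (fun t n => modulus (V2 t n)).
  move=> e e0; pose c := e / 2 / (L + 1).
  have c0 : 0 < c by rewrite !divr_gt0 // addr_gt0.
  have e20 : 0 < e / 2 by rewrite divr_gt0.
  have [F1 HF1] := tu02 _ e20; have [F2 HF2] := tD2 _ c0.
  exists (F1 `|` F2)%fset => t G tL FG.
  have d1 : [disjoint F1 & G]%fset.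
    by apply/fdisjointP => i iF; apply: (fdisjointP FG); rewrite inE iF.
  have d2 : [disjoint F2 & G]%fset.
    by apply/fdisjointP => i iF; apply: (fdisjointP FG); rewrite inE iF orbT.
  have bD z : segment0 L z -> \sum_(n <- G) freq omega n ^+ 2 * modulus (D z n) <= c.
    by move=> zL; have := HF2 z G zL d2; under eq_bigr do rewrite mfreq.
  have := weighted_mean_value (ltW L0) (fun n => sqr_ge0 (freq omega n)) dV
    (fun z _ => is_derive_linear c z) bD tL.
  under [X in _ -> X <= _]eq_bigr do rewrite mfreq.
  move/le_trans; apply; rewrite mulr0 subr0 (splitr e) lerD //.
    by have := HF1 0 G segm0 d1; under eq_bigr do rewrite mfreq -V0.
  case/andP: tL => t0 tL; rewrite /c mulrAC ler_pdivrMr ?addr_gt0 //.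
  by rewrite ler_wpM2l ?(ltW e20) // (le_trans tL) // lerDl.
pose V1 t n := ifreq omega n * V t n.
pose D2 t n := ifreq omega n ^+ 2 * D t n.
have lim t (tL : segment0 L t) d (d0 : 0 < d) := segment0_limit_point L0 tL d0.
have uxE t x : segment0 L t -> ux t x = qp_series omega (V1 t) x.
  move=> tL; have [_ /has_derivative_inP h _ _ _] := pde t x tL.
  have [M hM] := bnd _ t tV tL; have [N hN] := bnd _ t tV1 tL.
  apply: (derivative_at_unique (@setT_limit_point _ x) h).
  apply: derivative_at_ext (qp_derivative_x x hM hN) => // y _.
  by rewrite vE.
have uxxE t x : segment0 L t -> uxx t x = qp_series omega (V2 t) x.
  move=> tL; have [_ _ /has_derivative_inP h _ _] := pde t x tL.
  have [M hM] := bnd _ t tV1 tL; have [N hN] := bnd _ t tV2 tL.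
  have E : (fun n => ifreq omega n * V1 t n) = V2 t.
    by apply/funext => n; rewrite /V1 /V2 mulrA.
  apply: (derivative_at_unique (@setT_limit_point _ x) h).
  rewrite -E in hN *; apply: derivative_at_ext (qp_derivative_x x hM hN) => // y _.
  by rewrite uxE.
exists V; split=> // t n tL.
have utE x : ut t x = qp_series omega (D t) x.
  have [/has_derivative_inP + _ _ _ _] := pde t x tL; rewrite segment0E => h.
  apply: (derivative_at_unique (lim t tL) h).
  by apply: derivative_at_ext (qp_derivative_t omega x dV tV tD tL) => // y yL; rewrite vE.
have uxxtE x : uxxt t x = qp_series omega (D2 t) x.
  have [_ _ _ /has_derivative_inP + _] := pde t x tL; rewrite segment0E => h.
  apply: (derivative_at_unique (lim t tL) h).
  have dV2 z m : segment0 L z -> derivative_at (segment0 L) (V2^~ m) z (D2 z m).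
    by move=> zL; apply: derivative_atZ; exact: dV.
  by apply: derivative_at_ext (qp_derivative_t omega x dV2 tV2 tD2 tL) => // y yL; rewrite uxxE.
have [M hM] := bnd _ t tV tL; have [M1 hM1] := bnd _ t tV1 tL.
have [N hN] := bnd _ t tD tL; have [N2 hN2] := bnd _ t tD2 tL.
have hw : weighted_l1_le (freq_weight omega) (V t) (M + M1).
  have := finite_sums_leD hM hM1; apply: finite_sums_le_mono => // m /=.
  by rewrite modulusM modulus_ifreq /freq_weight mulrDl mul1r.
suff /(residual_eq0 omega q (V t) (D t) n) <- : residual omega q (V t) (D t) n = 0.
  exact: dV.
have res x : sums_to (fun m => residual omega q (V t) (D t) m * mode omega m x) 0.
  have [_ _ _ _ E] := pde t x tL.
  have := qp_equation q x hw hN hN2.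
  by rewrite -utE -uxxtE -uxE // -vE // E.
have [K hK] := residual_summable q hw hN hN2.
exact: fourier_coefficients_unique ind hK res n.
Qed.

End Uniqueness.

Theorem theoremA (R : realType) (p nu : nat) (hp : (2 <= p)%N)
    (hnu : (1 <= nu)%N) (omega : 'rV[R]_nu)
    (homega : rationally_independent omega)
    (A rho : R) (hA : 0 < A) (hrho : 0 < rho <= 1)
    (uh0 : 'rV[int]_nu -> Cplx R)
    (huh0 : forall n : 'rV[int]_nu,
       Normc.normc (uh0 n) <=
       A `^ (p.-1)%:R^-1 * expR (- rho * (norm1 n)%:R)) :
  exists u : R -> R -> Cplx R,
    classical_qp_solution p omega uh0 (lifespan p nu A rho) u /\
    forall v : R -> R -> Cplx R,
      classical_qp_solution p omega uh0 (lifespan p nu A rho) v ->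
      forall t x : R, 0 <= t <= lifespan p nu A rho -> v t x = u t x.
Proof.
case: p hp huh0 => [//|q]; rewrite ltnS => q0 huh0; have /andP[rho0 rho1] := hrho.
set L := lifespan _ _ _ _.
have L0 : 0 < L by exact: lifespan_gt0.
have s01 : 0 < rho / 2 <= 1 by apply/andP; split; lra.
have s0 : 0 <= rho / 2 by case/andP: s01 => /ltW.
have r0 := ltW (ball_radius_gt0 nu q0 hA rho0).
have contr : L * ball_radius nu q A rho ^+ q <= 1.
  by rewrite /L lifespan_ball_radius.
have Wsub := exp_weight_submultiplicative nu s0.
have WQ : finite_sums_le (fun n : 'rV[int]_nu => (exp_weight (rho / 2) n)^-1)
    ((3 / (rho / 2)) ^+ nu).
  apply: finite_sums_le_mono (finite_sums_le_exp_weight s01) => // n.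
  by rewrite exp_weightN.
have [U [U0 Ub dU]] := coefficient_solution_exists omega Wsub WQ (ltW L0) (data_in_ball (q := q) hA rho0 rho1 huh0) r0
  (ball_radius_stable nu q0 hA rho0) contr.
have sol : classical_qp_solution q.+1 omega uh0 L (fun t => qp_series omega (U t)).
  apply: (classical_solution_of_coefficients s01 (ltW L0) U0 Ub.1 dU).
  by move=> t n; exact: (continuous_rhs omega q Wsub WQ Ub n).
have B0 : 0 <= A `^ (q%:R^-1) by exact: powR_ge0.
exists (fun t => qp_series omega (U t)); split=> // v solv t x tL.
have [V [tV vE V0 dV]] := classical_solution_coefficients L0 homega hrho B0 huh0 solv.
have [U' [tU' uE U'0 dU']] := classical_solution_coefficients L0 homega hrho B0 huh0 sol.
rewrite vE // uE //; congr qp_series; apply/funext => n.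
apply: (coefficients_unique L0 tV tU' _ dV dU') => // m.
by rewrite V0 U'0.
Qed.
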